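(* Let $\mathcal X$ be a projective, geometrically irreducible, nonsingular curve of genus $g$ over $\mathbf F_q$. Let $D=P_1+\dots+P_n$ be a sum of $n$ pairwise distinct $\mathbf F_q$-rational points of $\mathcal X$, and let $G$ be an $\mathbf F_q$-rational divisor with $P_i\notin\operatorname{supp}(G)$ for all $i$. Let $\mathcal C=\mathcal C(\mathcal X,D,G)$, with dimension $k$, and put $m:=\deg(G)$. Assume $2k\le n$, $n>2g$, and $2m-n\ge -1$. Then $\Delta[\mathcal C]\le R(2m-n)$, and hence $s[\mathcal C]\ge w(\mathcal C)-R(2m-n)$.
   Context: For an $\mathbf F_q$-rational divisor $F$, $\mathcal L(F)$ is the space of rational functions $f$ over $\mathbf F_q$ with $f=0$ or $F+\operatorname{div}(f)\succeq 0$, and $\ell(F)=\dim_{\mathbf F_q}\mathcal L(F)$. The AG code $\mathcal C(\mathcal X,D,G)$ is the image of the map $\mathcal L(G)\to\mathbf F_q^n$, $f\mapsto(f(P_1),\dots,f(P_n))$. State complexity. For a linear $[n,k]$ code $\mathcal C$ with a fixed coordinate order, define the past and future subcodes: $\mathcal P_0=\mathcal F_n=0$, $\mathcal P_n=\mathcal F_0=\mathcal C$, and for $1\le i\le n-1$, $\mathcal P_i=\{(c_1,\dots,c_i):(c_1,\dots,c_i,0,\dots,0)\in\mathcal C\}$ and $\mathcal F_i=\{(c_{i+1},\dots,c_n):(0,\dots,0,c_{i+1},\dots,c_n)\in\mathcal C\}$. Put $\Delta_i=\dim\mathcal P_i+\dim\mathcal F_i$ and $\Delta(\mathcal C)=\min_{0\le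 i\le n}\Delta_i$. The state complexity of $\mathcal C$, i.e. the maximal $\log_q$ of the number of vertices at a level of its minimal trellis, equals $s(\mathcal C)=k-\Delta(\mathcal C)$. Let $[\mathcal C]$ be the set of codes obtained from $\mathcal C$ by permuting coordinates. Put $s[\mathcal C]=\min\{s(\mathcal C'):\mathcal C'\in[\mathcal C]\}$, $\Delta[\mathcal C]=\max\{\Delta(\mathcal C'):\mathcal C'\in[\mathcal C]\}$, and $w(\mathcal C)=\min\{k,n-k\}$. Gonality sequence. For $i\ge1$, $\gamma_i=\min\{\deg A: A\ \mathbf F_q\text{-rational divisor},\ \ell(A)\ge i\}$, and $GS(\mathcal X)=\{\gamma_i:i\ge1\}$. Let $\mathbf N'=\{-1,0,1,2,\dots\}$. Define $\tilde\ell:\mathbf N'\to\mathbf N_0$ by $\tilde\ell(-1)=0$ and $\tilde\ell(a)=\max\{i\ge1:\gamma_i\le a\}$ for $a\ge0$. Define $R$ on the integers $N$ with $-1\le N\le 2g-2$ by $R(N)=\min\{\tilde\ell(a)+\tilde\ell(b): a,b\in\mathbf N',\ a+b=N\}$. *)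

(* Defs.v *)
(* Curves over F_q are modelled by their function fields
   (Stichtenoth's setting): places = normalized discrete valuations of F/K. *)
From HB Require Import structures.
From mathcomp Require Import all_boot all_order all_fingroup all_algebra.
From Stdlib Require Import ClassicalEpsilon.
Set Implicit Arguments. Unset Strict Implicit. Unset Printing Implicit Defensive.
Import Order.TTheory GRing.Theory Num.Theory.
Local Open Scope ring_scope.

Definition cb (P : Prop) : bool := if excluded_middle_informative P then true else false.

Section FunctionField.
Variables (K : finFieldType) (F : fieldType) (iota : {rmorphism K -> F}).

(* F / K is an algebraic function field of one variable with full constant
   field K (= function field of a projective, geometrically irreducible,
   nonsingular curve over the perfect field K). *)
Definition function_field : Prop :=
  (exists x : F,
     (forall p : {poly K}, p != 0 -> (map_poly iota p).[x] != 0) /\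
     exists (r : nat) (y : 'I_r -> F), forall z : F,
       exists (a : 'I_r -> {poly K}) (b : {poly K}),
         b != 0 /\ (map_poly iota b).[x] * z = \sum_(i < r) (map_poly iota (a i)).[x] * y i)
  /\ (forall z : F, (exists p : {poly K}, p != 0 /\ (map_poly iota p).[z] = 0) ->
        exists c : K, z = iota c).

(* normalized discrete valuation of F/K, with the convention v 0 = 0
   (the value at 0 is never used; it is fixed only to make places unique) *)
Definition is_place (v : F -> int) : Prop :=
  [/\ v 0 = 0,
      forall x y, x != 0 -> y != 0 -> v (x * y) = v x + v y,
      forall x y, x != 0 -> y != 0 -> x + y != 0 -> Num.min (v x) (v y) <= v (x + y),
      forall c : K, c != 0 -> v (iota c) = 0
    & exists t : F, t != 0 /\ v t = 1].

Record place := Place { pval :> F -> int; pvalP : is_place pval }.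

Definition inmax (P : place) (x : F) : Prop := x = 0 \/ 0 < P x.
Definition inval (P : place) (x : F) : Prop := x = 0 \/ 0 <= P x.

Definition lincomb r (c : 'I_r -> K) (f : 'I_r -> F) : F := \sum_(i < r) iota (c i) * f i.

(* degree of a place = dimension of its residue field over K *)
Definition is_pdeg (P : place) (r : nat) : Prop :=
  exists f : 'I_r -> F, (forall i, inval P (f i)) /\
    (forall c, inmax P (lincomb c f) -> forall i, c i = 0) /\
    (forall g, inval P g -> exists c, inmax P (g - lincomb c f)).
Definition pdeg (P : place) : nat := epsilon (inhabits 0%N) (is_pdeg P).

(* value of f at a rational place P: the residue class of f *)
Definition evalp (P : place) (f : F) : K := epsilon (inhabits 0) (fun c => inmax P (f - iota c)).

Definition divisor := seq (place * int).
Definition dcoef (A : divisor) (P : place) : int :=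
  \sum_(x <- A) (if cb (x.1 = P) then x.2 else 0).
Definition ddeg (A : divisor) : int := \sum_(x <- A) x.2 * (pdeg x.1)%:Z.

Definition Lspace (A : divisor) (f : F) : Prop :=
  f = 0 \/ forall P : place, - dcoef A P <= P f.

Definition is_dim (S : F -> Prop) (r : nat) : Prop :=
  exists f : 'I_r -> F, (forall i, S (f i)) /\
    (forall c, lincomb c f = 0 -> forall i, c i = 0) /\
    (forall g, S g -> exists c, g = lincomb c f).
Definition ell (A : divisor) : nat := epsilon (inhabits 0%N) (is_dim (Lspace A)).

Definition genus : nat := epsilon (inhabits 0%N) (fun g : nat =>
  (forall A, ddeg A - (ell A)%:Z + 1 <= g%:Z) /\ exists A, ddeg A - (ell A)%:Z + 1 = g%:Z).

Definition gam (i : nat) : int := epsilon (inhabits 0) (fun d : int =>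
  (exists A, (i <= ell A)%N /\ ddeg A = d) /\ forall A, (i <= ell A)%N -> d <= ddeg A).

(* l~ : only used on N' = {-1,0,1,...}; l~(-1) = 0 *)
Definition ltil (a : int) : nat :=
  if a < 0 then 0%N else epsilon (inhabits 0%N) (fun i : nat =>
    [/\ (1 <= i)%N, gam i <= a & forall j : nat, (1 <= j)%N -> gam j <= a -> (j <= i)%N]).

(* R(N) = min { l~(a) + l~(b) : a, b >= -1, a + b = N },  for N >= -1.
   Index a' = a + 1 ranges over 0 .. N+2, and then b = N + 1 - a'. *)
Definition Rfun (N : int) : nat :=
  let h (a : 'I_(absz (N + 2)).+1) := (ltil (a%:Z - 1) + ltil (N + 1 - a%:Z))%N in
  h [arg min_(a < ord0) h a].

Definition AGcode (n : nat) (P : 'I_n -> place) (G : divisor) : {set 'rV[K]_n} :=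
  [set c | cb (exists f, Lspace G f /\ c = \row_i evalp (P i) f)].

End FunctionField.


Section Trellis.
Variable K : finFieldType.

Definition sdim m (S : {set 'rV[K]_m}) : nat :=
  \rank (\matrix_(r < #|S|) (@enum_val _ (mem S) r)).

Variable n : nat.
Implicit Type C : {set 'rV[K]_n}.

Definition pastset C (i : 'I_n.+1) : {set 'rV[K]_i} :=
  [set x : 'rV[K]_i | [exists c in C,
     [forall j : 'I_n, forall k : 'I_i, (val j == val k) ==> (c 0 j == x 0 k)] &&
     [forall j : 'I_n, (i <= j)%N ==> (c 0 j == 0)]]].

Definition futureset C (i : 'I_n.+1) : {set 'rV[K]_(n - i)} :=
  [set y : 'rV[K]_(n - i) | [exists c in C,
     [forall j : 'I_n, (j < i)%N ==> (c 0 j == 0)] &&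
     [forall j : 'I_n, forall k : 'I_(n - i), (val j == i + k)%N ==> (c 0 j == y 0 k)]]].

Definition Delta_i C (i : 'I_n.+1) : nat := (sdim (pastset C i) + sdim (futureset C i))%N.
Definition Delta C : nat := Delta_i C [arg min_(i < (ord0 : 'I_n.+1)) Delta_i C i].

Definition scomp C : nat := (sdim C - Delta C)%N.

Definition permcode (s : 'S_n) C : {set 'rV[K]_n} := [set \row_j c 0 (s j) | c : 'rV[K]_n in C].

Definition DeltaP C : nat :=
  Delta (permcode [arg max_(s > (1%g : 'S_n)) Delta (permcode s C)] C).
Definition scompP C : nat :=
  scomp (permcode [arg min_(s < (1%g : 'S_n)) scomp (permcode s C)] C).
Definition wcode C : nat := minn (sdim C) (n - sdim C).
End Trellis.

(* Main.v *)
(* Split a coordinate order at position i. Codewords supported on the first i (last n - i)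
   coordinates come from functions in L(G - P_(i+1) - ... - P_n) (in L(G - P_1 - ... - P_i)), so
   Delta_i <= ell(A) + ell(B) for two divisors with deg A + deg B = 2m - n, and i can be chosen so
   that (deg A, deg B) is the pair (a, b) attaining R(2m - n); then ell(A) <= l~(a), ell(B) <= l~(b).
   This needs m < n. If m >= n, the Riemann inequality for G and ell(G - D) <= m - n + 1 give
   k >= n - g > n/2, against 2k <= n.

   The function field theory behind this rests on one criterion: if f_1, ..., f_r lie in a ring O
   and are K-independent modulo a subspace I of O containing xO, they are independent over K[x].
   The size of K[x]-independent families is bounded, which gives finiteness of residue fields, of
   zeros and of poles, and discreteness of the valuation rings provided by Zorn's lemma.
   Approximation turns the zeros of x into a K[x]-independent family of size the degree of the zero
   divisor Z; conversely r independent functions make ell(l Z + C) >= r (l + 1) for all l, whence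
   r <= deg Z. So principal divisors have degree 0, and the same lower bound for ell(l Z + C) yields
   Riemann's theorem. *)
Require Import Defs.
From HB Require Import structures.
From mathcomp Require Import all_boot all_order all_fingroup all_algebra.
From mathcomp Require Import zify ring.
From mathcomp Require classical_sets.
From Stdlib Require Import Classical ClassicalEpsilon FunctionalExtensionality ProofIrrelevance.
Set Implicit Arguments. Unset Strict Implicit. Unset Printing Implicit Defensive.
Import Order.TTheory GRing.Theory Num.Theory.
Local Open Scope ring_scope.

Lemma ex_maxP (P : nat -> Prop) (N k : nat) : P k -> (forall r, P r -> (r <= N)%N) ->
  exists2 r, P r & forall s, P s -> (s <= r)%N.
Proof.
move=> Pk PN; have [m] := ubnP (N - k)%N; elim: m k Pk => // m IH k Pk Hm.
case: (classic (exists2 s, P s & (k < s)%N)) => [[s Ps ks]|Hn].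
  by apply: (IH s Ps); have := PN _ Ps; lia.
exists k => // s Ps; rewrite leqNgt; apply/negP => ks; apply: Hn; by exists s.
Qed.

(** * Linear algebra modulo a subspace *)

(** With W = 0 the relative notions below become ordinary independence and dimension over K. *)
Definition zero_only {F : fieldType} (x : F) : Prop := x = 0.

Section LinearAlgebra.
Variables (K : finFieldType) (F : fieldType) (iota : {rmorphism K -> F}).
Implicit Types (V W U : F -> Prop).

Definition comb (T : finType) (c : T -> K) (f : T -> F) : F := \sum_t iota (c t) * f t.
Definition subspace W := W 0 /\ forall c x y, W x -> W y -> W (iota c * x + y).
Definition free_mod (T : finType) W (f : T -> F) :=
  forall c, W (comb c f) -> forall t, c t = 0.
Definition spans_mod (T : finType) V W (f : T -> F) :=
  forall g, V g -> exists c, W (g - comb c f).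
(** For W inside V this is dim V/W = r. It covers residue fields ([inval] modulo [inmax]), the
    spaces L(A) (modulo [zero_only]) and quotients L(B)/L(A). *)
Definition rdim V W (r : nat) := exists f : 'I_r -> F,
  (forall i, V (f i)) /\ free_mod W f /\ spans_mod V W f.


Lemma subspace0 : subspace zero_only.
Proof. by split=> // c x y -> ->; rewrite mulr0 addr0. Qed.

Lemma is_dimE V r : is_dim iota V r <-> rdim V zero_only r.
Proof.
split=> -[f [fV [ff fs]]]; exists f; do ?split=> //; move=> g /fs [c Hc]; exists c.
  by rewrite /zero_only Hc subrr.
by apply/eqP; rewrite -subr_eq0; apply/eqP.
Qed.

Lemma subspaceD W x y : subspace W -> W x -> W y -> W (x + y).
Proof. by move=> [_ h] hx hy; have := h 1 _ _ hx hy; rewrite rmorph1 mul1r. Qed.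
Lemma subspaceZ W c x : subspace W -> W x -> W (iota c * x).
Proof. by move=> [h0 h] hx; rewrite -[_ * _]addr0; apply: h. Qed.
Lemma subspaceN W x : subspace W -> W x -> W (- x).
Proof. by move=> hW hx; have := subspaceZ (-1) hW hx; rewrite rmorphN1 mulN1r. Qed.
Lemma subspaceB W x y : subspace W -> W x -> W y -> W (x - y).
Proof. by move=> hW hx hy; apply: subspaceD => //; apply: subspaceN. Qed.

Lemma subspace_sum W (T : finType) (f : T -> F) : subspace W -> (forall t, W (f t)) ->
  W (\sum_t f t).
Proof. by move=> hW hf; elim/big_ind: _ => //; [case: hW | move=> ?? ??; apply: subspaceD]. Qed.

Lemma subspace_comb W (T : finType) c (f : T -> F) : subspace W -> (forall t, W (f t)) ->
  W (comb c f).
Proof. by move=> hW hf; apply: subspace_sum => // t; apply: subspaceZ. Qed.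

Lemma combZ (T : finType) a c (f : T -> F) : comb (fun t => a * c t) f = iota a * comb c f.
Proof. by rewrite /comb mulr_sumr; apply: eq_bigr => t _; rewrite rmorphM mulrA. Qed.
Lemma comb_scale (T : finType) c z (f : T -> F) : comb c (fun t => z * f t) = z * comb c f.
Proof. by rewrite /comb mulr_sumr; apply: eq_bigr => t _; rewrite mulrCA. Qed.
Lemma comb_delta (T : finType) t (f : T -> F) : comb (fun s => (s == t)%:R) f = f t.
Proof.
rewrite /comb (bigD1 t) //= eqxx rmorph1 mul1r big1 ?addr0 // => s /negbTE ->.
by rewrite rmorph0 mul0r.
Qed.
Lemma comb_sum (S T : finType) c (f : S + T -> F) :
  comb c f = comb (fun s => c (inl s)) (fun s => f (inl s)) +
             comb (fun s => c (inr s)) (fun s => f (inr s)).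
Proof. by rewrite /comb big_sumType. Qed.

(** Writing each g_t modulo W in terms of f gives a #|T| by #|S| matrix. If #|T| > #|S|, a nonzero
    vector of its left kernel is a relation among the g_t modulo W. *)
Lemma steinitz (S T : finType) V W (f : S -> F) (g : T -> F) : subspace W ->
  spans_mod V W f -> (forall t, V (g t)) -> free_mod W g -> (#|T| <= #|S|)%N.
Proof.
move=> hW hs hg hfr; rewrite leqNgt; apply/negP => lt.
pose cf t := epsilon (inhabits (fun=> 0)) (fun c => W (g t - comb c f)).
have cfP t : W (g t - comb (cf t) f) by exact: (epsilon_spec _ (fun c => W (g t - comb c f)) (hs _ (hg t))).
pose M : 'M[K]_(#|T|, #|S|) := \matrix_(i, j) cf (enum_val i) (enum_val j).
have : kermx M != 0.
  rewrite -mxrank_eq0 mxrank_ker subn_eq0 -ltnNge.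
  exact: leq_ltn_trans (rank_leq_col M) lt.
case/rowV0Pn => u /sub_kermxP uM /eqP; apply; apply/rowP => i; rewrite mxE.
have -> : i = enum_rank (enum_val i) by rewrite enum_valK.
apply: (hfr (fun t => u 0 (enum_rank t))) => {i}.
have -> : comb (fun t => u 0 (enum_rank t)) g =
   \sum_t iota (u 0 (enum_rank t)) * (g t - comb (cf t) f) +
   \sum_t iota (u 0 (enum_rank t)) * comb (cf t) f.
  by rewrite -big_split; apply: eq_bigr => t _ /=; rewrite -mulrDr subrK.
have -> : \sum_t iota (u 0 (enum_rank t)) * comb (cf t) f = 0.
  under eq_bigr do rewrite /comb mulr_sumr.
  rewrite exchange_big big1 // => s _ /=.
  under eq_bigr do rewrite mulrA -rmorphM.
  rewrite -mulr_suml -rmorph_sum /=.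
  have := congr1 (fun A : 'rV_#|S| => A 0 (enum_rank s)) uM; rewrite !mxE => h.
  have -> : \sum_i u 0 (enum_rank i) * cf i s = 0; last by rewrite rmorph0 mul0r.
  apply: etrans h; rewrite (reindex_onto (@enum_val T (mem T)) enum_rank) /=; last by move=> i _; rewrite enum_rankK.
  apply: eq_big => [i|i _]; first by rewrite enum_valK eqxx.
  by rewrite enum_valK mxE enum_rankK.
rewrite addr0; apply: subspace_sum => // t; exact: subspaceZ.
Qed.

Lemma free_rdim_le V W r (T : finType) (g : T -> F) : subspace W -> rdim V W r ->
  (forall t, V (g t)) -> free_mod W g -> (#|T| <= r)%N.
Proof. by move=> hW [f [_ [_ fs]]] gV gf; rewrite -(card_ord r); apply: (steinitz hW fs gV gf). Qed.

Lemma rdim_uniq V W r s : subspace W -> rdim V W r -> rdim V W s -> r = s.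
Proof.
move=> hW hr hs; apply/eqP; rewrite eqn_leq.
case: (hr) (hs) => f [fV [ff _]] [g [gV [gf _]]].
by rewrite -{1}(card_ord r) -{2}(card_ord s) (free_rdim_le hW hs fV ff) (free_rdim_le hW hr gV gf).
Qed.

Lemma free_mod_reindex W (S T : finType) (h : S -> T) (f : T -> F) : bijective h ->
  free_mod W f -> free_mod W (fun s => f (h s)).
Proof.
move=> [k hk kh] ff c Hc s; rewrite -(hk s); apply: (ff (fun t => c (k t))).
suff -> : comb (fun t => c (k t)) f = comb c (fun s => f (h s)) by [].
rewrite /comb (reindex h) /=; first by apply: eq_bigr => t _; rewrite hk.
by exists k => t _.
Qed.

Lemma free_mod_ord W (T : finType) (f : T -> F) : free_mod W f ->
  free_mod W (fun i : 'I_#|T| => f (enum_val i)).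
Proof.
apply: free_mod_reindex; exists enum_rank => i; [exact: enum_valK|exact: enum_rankK].
Qed.

(** A free family of maximal size spans: an element outside its span could be adjoined. *)
Lemma free_rdim_ex V W N : subspace W ->
  (forall r (f : 'I_r -> F), (forall i, V (f i)) -> free_mod W f -> (r <= N)%N) ->
  exists2 r, (r <= N)%N & rdim V W r.
Proof.
move=> hW HN.
pose Q r := exists f : 'I_r -> F, (forall i, V (f i)) /\ free_mod W f.
have Q0 : Q 0%N by exists (fun=> 0); split=> [[]//|c _ []].
have QN r : Q r -> (r <= N)%N by case=> f [fV ff]; apply: HN ff.
have [r [f [fV ff]] rmax] := ex_maxP Q0 QN.
exists r; first exact: (HN _ f).
exists f; do 2?split=> //; move=> g gV; apply: NNPP => Hn.
suff : (r.+1 <= r)%N by rewrite ltnn.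
apply: rmax; pose h (t : 'I_r + unit) := match t with inl i => f i | inr _ => g end.
have hf : free_mod W h.
  move=> c; rewrite comb_sum /= => Hc.
  have Ec : comb (fun s : unit => c (inr s)) (fun=> g) = iota (c (inr tt)) * g.
    by rewrite /comb (bigD1 tt) //= big1 ?addr0 // => -[].
  rewrite Ec in Hc.
  have c0 : c (inr tt) = 0.
    apply/eqP/negPn/negP => c0; apply: Hn; exists (fun i => - (c (inr tt))^-1 * c (inl i)).
    rewrite combZ rmorphN mulNr opprK.
    have := subspaceZ (c (inr tt))^-1 hW Hc.
    by rewrite mulrDr mulrA -rmorphM mulVf // rmorph1 mul1r addrC.
  move: Hc; rewrite c0 rmorph0 mul0r addr0 => /ff Hc [i|[]] //; exact: Hc.
have E : #|{: 'I_r + unit}| = r.+1 by rewrite card_sum card_ord card_unit addn1.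
exists (fun i : 'I_r.+1 => h (enum_val (cast_ord (esym E) i))); split.
  by move=> i; case: (enum_val _) => [j|[]] /=.
apply: free_mod_reindex hf; exists (fun t => cast_ord E (enum_rank t)) => t.
  by rewrite enum_valK cast_ordKV.
by rewrite cast_ordK enum_rankK.
Qed.

Lemma rdim_card V W (T : finType) (f : T -> F) : (forall t, V (f t)) -> free_mod W f ->
  spans_mod V W f -> rdim V W #|T|.
Proof.
move=> fV ff fs; exists (fun i => f (enum_val i)); split=> //; split; first exact: free_mod_ord.
move=> g /fs [c Hc]; exists (fun i => c (enum_val i)).
suff -> : comb (fun i : 'I_#|T| => c (enum_val i)) (fun i => f (enum_val i)) = comb c f by [].
rewrite /comb [RHS](reindex (@enum_val T (mem T))) //=.
by exists enum_rank => t _; [rewrite enum_valK|rewrite enum_rankK].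
Qed.

Lemma rdim_add V W U r s : subspace W -> subspace U -> (forall x, U x -> W x) ->
  (forall x, W x -> V x) ->
  rdim V W r -> rdim W U s -> rdim V U (r + s).
Proof.
move=> hW hU UW WV [f [fV [ff fs]]] [g [gW [gf gs]]].
pose h (t : 'I_r + 'I_s) := match t with inl i => f i | inr j => g j end.
have -> : (r + s)%N = #|{: 'I_r + 'I_s}| by rewrite card_sum !card_ord.
apply: (@rdim_card _ _ _ h).
- by move=> [i|j] /=; [apply: fV|apply/WV/gW].
- move=> c; rewrite comb_sum /= => Hc.
  have c1 : forall i, c (inl i) = 0.
    apply: ff; have := subspaceB hW (UW _ Hc) (subspace_comb (fun j => c (inr j)) hW gW).
    by rewrite addrK.
  have E0 : comb (fun i => c (inl i)) f = 0.
    by rewrite /comb big1 // => i _; rewrite c1 rmorph0 mul0r.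
  by move: Hc; rewrite E0 add0r => /gf Hc [i|j].
- move=> x /fs [c /gs [d Hd]].
  exists (fun t : 'I_r + 'I_s => match t with inl i => c i | inr j => d j end).
  by rewrite comb_sum /= opprD addrA.
Qed.

Lemma rdim_sub V V' W r : subspace W -> (forall x, V' x -> V x) -> rdim V W r ->
  exists2 s, (s <= r)%N & rdim V' W s.
Proof.
move=> hW hV hr; apply: free_rdim_ex => // s f fV ff.
rewrite -(card_ord s); apply: (free_rdim_le hW hr) ff => i; exact: hV.
Qed.

(** Multiplication by z is an isomorphism from V'/W' to V/W. *)
Lemma rdim_scale V W V' W' r z : z != 0 -> (forall x, V' x <-> V (z * x)) ->
  (forall x, W' x <-> W (z * x)) -> rdim V W r -> rdim V' W' r.
Proof.
move=> z0 VV WW [f [fV [ff fs]]]; exists (fun i => z^-1 * f i); split; last split.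
- by move=> i; apply/VV; rewrite mulVKf.
- by move=> c; rewrite comb_scale => /WW; rewrite mulVKf // => /ff.
- move=> g /VV /fs [c Hc]; exists c; apply/WW.
  by rewrite comb_scale mulrBr mulVKf.
Qed.

End LinearAlgebra.

(** * Independence over K[x] *)

Section Independence.
Variables (K : finFieldType) (F : fieldType) (iota : {rmorphism K -> F}).

(* Linear independence over K[x], phrased as K-linear independence of all x^j f_t. *)
Definition xindep (x : F) (T : finType) (f : T -> F) :=
  forall N, free_mod iota zero_only (fun tj : T * 'I_N => x ^+ tj.2 * f tj.1).

Lemma comb_pair (S T : finType) c (f : S * T -> F) :
  comb iota c f = \sum_s \sum_t iota (c (s, t)) * f (s, t).
Proof. by rewrite /comb pair_bigA; apply: eq_bigr => -[]. Qed.

Lemma eq_comb (T : finType) c d (f g : T -> F) : c =1 d -> f =1 g -> comb iota c f = comb iota d g.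
Proof. by move=> E1 E2; apply: eq_bigr => t _; rewrite E1 E2. Qed.

(** Multiplying a relation in the powers x^-j, j < N, by x^(N-1) reverses the exponents. *)
Lemma xindep_inv x (T : finType) (f : T -> F) : x != 0 -> xindep x f -> xindep x^-1 f.
Proof.
move=> x0 xf N c Hc [t j].
pose d (tj : T * 'I_N) := c (tj.1, rev_ord tj.2).
rewrite -(rev_ordK j); apply: (xf N d _ (t, rev_ord j)); rewrite /zero_only.
suff -> : comb iota d (fun tj => x ^+ tj.2 * f tj.1) =
  x ^+ N.-1 * comb iota c (fun tj => x^-1 ^+ tj.2 * f tj.1) by rewrite Hc mulr0.
rewrite -comb_scale !comb_pair; apply: eq_bigr => s _.
rewrite [LHS](reindex_inj rev_ord_inj); apply: eq_bigr => i _ /=.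
rewrite /d /= rev_ordK; congr (_ * _); rewrite mulrA; congr (_ * _).
have -> : N.-1 = (N - i.+1 + i)%N by have := ltn_ord i; lia.
by rewrite exprD -mulrA -exprMn mulfV // expr1n mulr1.
Qed.

(** Since x O lies in I, only the terms with exponent 0 of a relation survive modulo I. Their
    coefficients vanish, x can be divided out, and induction on the number of exponents applies. *)
Lemma xindep_of_free (O I : F -> Prop) x (T : finType) (f : T -> F) : x != 0 ->
  subspace iota O -> subspace iota I -> (forall w, I w -> O w) -> (forall w, O w -> I (x * w)) ->
  (forall t, O (f t)) -> free_mod iota I f -> xindep x f.
Proof.
move=> x0 hO hI IO xO fO ff; elim=> [|N IH] c Hc; first by case=> ? [].
have E : comb iota c (fun tj => x ^+ tj.2 * f tj.1) = comb iota (fun t => c (t, ord0)) f +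
   x * comb iota (fun tj : T * 'I_N => c (tj.1, lift ord0 tj.2)) (fun tj => x ^+ tj.2 * f tj.1).
  rewrite -comb_scale !comb_pair /comb -big_split /=; apply: eq_bigr => t _.
  rewrite big_ord_recl /= expr0 mul1r; congr (_ + _); apply: eq_bigr => j _.
  by rewrite exprS !mulrA.
rewrite /zero_only E in Hc.
have xO' w : O w -> O (x * w) by move=> /xO /IO.
have Ox j w : O w -> O (x ^+ j * w).
  by elim: j w => [|j IHj] w Ow; rewrite ?expr0 ?mul1r // exprS -mulrA; apply/xO'/IHj.
have c0 : forall t, c (t, ord0) = 0.
  apply: (ff (fun t => c (t, ord0))); have /eqP := Hc; rewrite addr_eq0 => /eqP ->.
  apply: (subspaceN hI); apply: xO; apply: (subspace_comb _ hO) => -[t j] /=; exact: Ox.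
have E0 : comb iota (fun t => c (t, ord0)) f = 0.
  by rewrite /comb big1 // => t _; rewrite c0 rmorph0 mul0r.
move: Hc; rewrite E0 add0r => /eqP; rewrite mulf_eq0 (negbTE x0) => /eqP /IH Hc [t j].
case: (unliftP ord0 j) => [i ->|-> //]; exact: (Hc (t, i)).
Qed.

Lemma map_polyE x (p : {poly K}) N : (size p <= N)%N ->
  (map_poly iota p).[x] = \sum_(j < N) iota p`_j * x ^+ j.
Proof.
move=> sp; rewrite (@horner_coef_wide _ N) ?size_map_poly //.
by apply: eq_bigr => j _; rewrite coef_map.
Qed.

Lemma xindep1 x : (forall p : {poly K}, p != 0 -> (map_poly iota p).[x] != 0) ->
  xindep x (fun _ : unit => 1).
Proof.
move=> hx N c Hc [[] j].
pose p := \poly_(i < N) (if insub i is Some j then c (tt, j) else 0).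
have pj (i : 'I_N) : p`_i = c (tt, i) by rewrite coef_poly ltn_ord valK.
have p0 : p == 0.
  apply/negPn/negP => /hx /eqP; apply.
  rewrite (@map_polyE _ _ N) ?size_poly //; move: Hc; rewrite /zero_only comb_pair.
  rewrite (bigD1 tt) //= big_pred0_eq addr0 => h; apply: etrans h.
  by apply: eq_bigr => i _; rewrite pj mulr1.
by rewrite -pj (eqP p0) coef0.
Qed.

Lemma transcendental x : function_field iota -> (forall c, x <> iota c) ->
  forall p : {poly K}, p != 0 -> (map_poly iota p).[x] != 0.
Proof.
move=> [_ hF] hx p p0; apply/eqP => px; have [|c xc] := hF x; first by exists p.
exact: hx xc.
Qed.

(** * A uniform bound on the size of K[x]-independent families *)

Section Bound.
Variables (x0 : F) (r : nat) (y : 'I_r -> F).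
Hypothesis x0P : forall p : {poly K}, p != 0 -> (map_poly iota p).[x0] != 0.
Hypothesis yP : forall z : F, exists (a : 'I_r -> {poly K}) (b : {poly K}),
  b != 0 /\ (map_poly iota b).[x0] * z = \sum_(i < r) (map_poly iota (a i)).[x0] * y i.

Local Notation ev p := ((map_poly iota p).[x0]).

(** The K[x0]-span of [y], filtered by degree so that every layer has finite dimension over K. *)
Definition Vdeg (d : nat) (z : F) := exists a : 'I_r -> {poly K},
  (forall i, size (a i) <= d)%N /\ z = \sum_(i < r) ev (a i) * y i.

Lemma evM p q : ev (p * q) = ev p * ev q. Proof. by rewrite rmorphM hornerM. Qed.
Lemma evD p q : ev (p + q) = ev p + ev q. Proof. by rewrite rmorphD hornerD. Qed.

Lemma Vdeg0 d : Vdeg d 0.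
Proof.
exists (fun=> 0); split=> [i|]; first by rewrite size_poly0.
by rewrite big1 // => i _; rewrite rmorph0 horner0 mul0r.
Qed.
Lemma VdegD d z w : Vdeg d z -> Vdeg d w -> Vdeg d (z + w).
Proof.
move=> [a [sa ->]] [b [sb ->]]; exists (fun i => a i + b i); split=> [i|].
  by rewrite (leq_trans (size_polyD _ _)) // geq_max sa sb.
by rewrite -big_split; apply: eq_bigr => i _; rewrite evD mulrDl.
Qed.
Lemma VdegM d (p : {poly K}) z : Vdeg d z -> Vdeg (size p + d) (ev p * z).
Proof.
move=> [a [sa ->]]; exists (fun i => p * a i); split=> [i|].
  apply: leq_trans (size_polyMleq _ _) _; have := sa i; lia.
by rewrite mulr_sumr; apply: eq_bigr => i _; rewrite evM mulrA.
Qed.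
Lemma Vdeg_le d e z : (d <= e)%N -> Vdeg d z -> Vdeg e z.
Proof. by move=> de [a [sa ->]]; exists a; split=> // i; apply: leq_trans de. Qed.

Lemma common_den (s : seq F) : exists b d, b != 0 /\ forall z, z \in s -> Vdeg d (ev b * z).
Proof.
elim: s => [|u s [b [d [b0 Hb]]]]; first by exists 1, 0%N; split=> //; rewrite oner_eq0.
have [a [c [c0 Hc]]] := yP u.
have ha : Vdeg (\max_i size (a i)) (ev c * u).
  by exists a; split=> // i; exact: (leq_bigmax (F := fun i => size (a i))).
exists (b * c), (maxn (size b + \max_i size (a i)) (size c + d)).
split; first by rewrite mulf_neq0.
move=> z; rewrite inE => /orP[/eqP ->|/Hb hz].
  by rewrite evM -mulrA; apply: Vdeg_le (VdegM b ha); rewrite leq_maxl.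
by rewrite (mulrC b) evM -mulrA; apply: Vdeg_le (VdegM c hz); rewrite leq_maxr.
Qed.

Lemma Vdeg_span d : spans_mod iota (Vdeg d) zero_only (fun ij : 'I_r * 'I_d => x0 ^+ ij.2 * y ij.1).
Proof.
move=> _ [a [sa ->]]; exists (fun ij : 'I_r * 'I_d => (a ij.1)`_ij.2); rewrite /zero_only comb_pair.
apply/eqP; rewrite subr_eq0; apply/eqP; apply: eq_bigr => i _.
by rewrite (map_polyE _ (sa i)) mulr_suml; apply: eq_bigr => j _; rewrite mulrA.
Qed.

(* Dimension count: with b a common denominator of the x * y_j, the products b^D x^i u_t for
   i < D lie in the space of x0-degree at most d + D e, whose dimension is r (d + D e). *)
Lemma xindep_bound_gen x : exists M, forall (T : finType) (u : T -> F), xindep x u -> (#|T| <= M)%N.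
Proof.
have [b [e [b0 Hb]]] := common_den [seq x * y i | i : 'I_r].
pose e' := (size b + e)%N; exists (r * e')%N => T u xu.
have Vx k z : Vdeg k z -> Vdeg (k + e') (ev b * (x * z)).
  move=> [a [sa ->]]; rewrite !mulr_sumr.
  elim/big_ind: _ => [||i _]; [exact: Vdeg0|by move=> ??; apply: VdegD|].
  have -> : ev b * (x * (ev (a i) * y i)) = ev (a i) * (ev b * (x * y i)) by ring.
  apply: Vdeg_le (VdegM (a i) (Hb _ _)); last by apply: map_f; rewrite mem_enum.
  by rewrite /e'; have := sa i; lia.
have Vb k z : Vdeg k z -> Vdeg (k + e') (ev b * z).
  by move=> hz; apply: Vdeg_le (VdegM b hz); rewrite /e'; lia.
have [bu [d [bu0 Hu]]] := common_den [seq u t | t : T].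
have key D i k z : (i <= D)%N -> Vdeg k z -> Vdeg (k + D * e') (ev b ^+ D * (x ^+ i * z)).
  elim: D i => [|D IH] i; first by rewrite leqn0 => /eqP -> ; rewrite !expr0 !mul1r mul0n addn0.
  have -> : (k + D.+1 * e' = k + D * e' + e')%N by rewrite mulSn; lia.
  case: i => [_|i /IH h] hz.
    by rewrite exprS -mulrA; apply: Vb; apply: IH.
  have -> : ev b ^+ D.+1 * (x ^+ i.+1 * z) = ev b * (x * (ev b ^+ D * (x ^+ i * z))).
    by rewrite !exprS; ring.
  by apply: Vx; apply: h.
have main D : (#|T| * D <= r * (d + D * e'))%N.
  pose z := ev b ^+ D * ev bu.
  have z0 : z != 0 by rewrite mulf_neq0 ?expf_neq0 ?x0P.
  have := @steinitz _ _ iota _ {: T * 'I_D} _ _ _ (fun ti => z * (x ^+ ti.2 * u ti.1))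
     (subspace0 iota) (@Vdeg_span (d + D * e')).
  rewrite !card_prod !card_ord; apply.
  - move=> [t i] /=.
    have -> : z * (x ^+ i * u t) = ev b ^+ D * (x ^+ i * (ev bu * u t)) by rewrite /z; ring.
    apply: key; first exact: ltnW.
    by apply: Hu; apply: map_f; rewrite mem_enum.
  - move=> c; rewrite comb_scale /zero_only => /eqP; rewrite mulf_eq0 (negbTE z0) => /eqP.
    exact: xu.
(* If #|T| > r e', then [main] gives D <= r d for every D, which fails at D = r d + 1. *)
rewrite leqNgt; apply/negP => lt.
have := main (r * d).+1; nia.
Qed.

End Bound.

Lemma xindep_bound x : function_field iota ->
  exists M, forall (T : finType) (u : T -> F), xindep x u -> (#|T| <= M)%N.
Proof. by move=> [[x0 [x0P [r [y yP]]]] _]; apply: xindep_bound_gen yP _. Qed.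

End Independence.

(** * Existence of places *)

Section PlaceExistence.
Variables (K : finFieldType) (F : fieldType) (iota : {rmorphism K -> F}).

Definition ksubring (R : F -> Prop) :=
  [/\ forall c, R (iota c), forall x y, R x -> R y -> R (x + y)
    & forall x y, R x -> R y -> R (x * y)].

Section Subring.
Variable (R : F -> Prop).
Hypothesis hR : ksubring R.

Lemma ksub_iota c : R (iota c). Proof. by case: hR. Qed.
Lemma ksub1 : R 1. Proof. by rewrite -(rmorph1 iota); apply: ksub_iota. Qed.
Lemma ksub0 : R 0. Proof. by rewrite -(rmorph0 iota); apply: ksub_iota. Qed.
Lemma ksubD x y : R x -> R y -> R (x + y). Proof. by case: hR => _ h _; apply: h. Qed.
Lemma ksubM x y : R x -> R y -> R (x * y). Proof. by case: hR => _ _ h; apply: h. Qed.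
Lemma ksubN x : R x -> R (- x).
Proof. by move=> hx; rewrite -mulN1r -(rmorphN1 iota); apply: ksubM => //; apply: ksub_iota. Qed.
Lemma ksubX x n : R x -> R (x ^+ n).
Proof. by move=> hx; elim: n => [|n IH]; rewrite ?expr0 ?exprS; [apply: ksub1|apply: ksubM]. Qed.
Lemma ksub_subspace : subspace iota R.
Proof.
by split=> [|c x y hx hy]; [apply: ksub0|apply: ksubD => //; apply: ksubM => //; apply: ksub_iota].
Qed.

(** [n] counts terms: [Apoly z 0] is zero and [Apoly z 1] is R. The descent below shortens such
    expressions of 1/t. *)
Definition Apoly (z : F) (n : nat) (w : F) :=
  exists a : nat -> F, (forall i, R (a i)) /\ w = \sum_(i < n) a i * z ^+ i.

Lemma Apoly0 z n : Apoly z n 0.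
Proof. by exists (fun=> 0); split=> [_|]; [apply: ksub0|rewrite big1 // => i _; rewrite mul0r]. Qed.
Lemma ApolyD z n u w : Apoly z n u -> Apoly z n w -> Apoly z n (u + w).
Proof.
move=> [a [ha ->]] [b [hb ->]]; exists (fun i => a i + b i); split=> [i|]; first exact: ksubD.
by rewrite -big_split; apply: eq_bigr => i _; rewrite mulrDl.
Qed.
Lemma Apoly_mon z n a i : R a -> (i < n)%N -> Apoly z n (a * z ^+ i).
Proof.
move=> ha hi; exists (fun j => if j == i then a else 0); split=> [j|].
  by case: ifP => _ //; apply: ksub0.
rewrite (bigD1 (Ordinal hi)) //= eqxx big1 ?addr0 // => j ji.
by rewrite ifN ?mul0r //; apply: contra ji => /eqP E; apply/eqP/val_inj.
Qed.
Lemma Apoly_sum z n m (f : nat -> F) : (forall i, (i < m)%N -> Apoly z n (f i)) ->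
  Apoly z n (\sum_(i < m) f i).
Proof. by move=> h; elim/big_ind: _ => [||i _]; [apply: Apoly0|apply: ApolyD|apply: h]. Qed.
Lemma ApolyM z n m u w : Apoly z n u -> Apoly z m w -> Apoly z (n + m) (u * w).
Proof.
move=> [a [ha ->]] [b [hb ->]]; rewrite mulr_suml.
apply: (Apoly_sum (f := fun i => a i * z ^+ i * _)) => i hi; rewrite mulr_sumr.
apply: (Apoly_sum (f := fun j => a i * z ^+ i * (b j * z ^+ j))) => j hj.
have -> : a i * z ^+ i * (b j * z ^+ j) = (a i * b j) * z ^+ (i + j) by rewrite exprD; ring.
by apply: Apoly_mon; [apply: ksubM|lia].
Qed.
Lemma Apoly_le z n m u : (n <= m)%N -> Apoly z n u -> Apoly z m u.
Proof.
move=> nm [a [ha ->]]; apply: (Apoly_sum (f := fun i => a i * z ^+ i)) => i hi.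
by apply: Apoly_mon => //; apply: leq_trans nm.
Qed.

Variable t : F.
Hypothesis tR : R t.
Hypothesis tVR : ~ R t^-1.

Lemma ksub_t_neq0 : t != 0.
Proof. by apply/eqP => t0; apply: tVR; rewrite t0 invr0; apply: ksub0. Qed.

(* Chevalley's trick: 1 - t b_0 = t (b_1 z^-1 + ... + b_m z^-m) is used to eliminate the leading
   term of the expression of 1/t as a polynomial in z. *)
Lemma Apoly_descent z n m : z != 0 -> (m <= n)%N -> (0 < n)%N ->
  Apoly z n.+1 t^-1 -> Apoly z^-1 m.+1 t^-1 -> Apoly z n t^-1.
Proof.
move=> z0 mn n0 [a [ha Ea]] [b [hb Eb]].
have t0 := ksub_t_neq0.
have -> : t^-1 = (1 - t * b 0%N) * (\sum_(i < n) a i * z ^+ i) + b 0%N * z ^+ 0 +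
   \sum_(j < m) (a n * t * b j.+1) * z ^+ (n - j.+1).
  have -> : \sum_(j < m) (a n * t * b j.+1) * z ^+ (n - j.+1) = (1 - t * b 0%N) * (a n * z ^+ n).
    have -> : 1 - t * b 0%N = t * \sum_(j < m) b j.+1 * z^-1 ^+ j.+1.
      move: Eb; rewrite big_ord_recl expr0 mulr1 => Eb.
      by rewrite -(mulfV t0) Eb mulrDr addrC addKr.
    rewrite mulr_sumr mulr_suml; apply: eq_bigr => j _.
    have E : z ^+ n = z ^+ (n - j.+1) * z ^+ j.+1 by rewrite -exprD subnK // (leq_trans (ltn_ord j)).
    by rewrite E exprVn; field; rewrite expf_neq0.
  have -> : \sum_(i < n) a i * z ^+ i = t^-1 - a n * z ^+ n by rewrite Ea big_ord_recr addrK.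
  by rewrite expr0; field.
apply: ApolyD; last first.
  apply: (Apoly_sum (f := fun j => (a n * t * b j.+1) * z ^+ (n - j.+1))) => j hj.
  by apply: Apoly_mon; [do !apply: ksubM | lia].
apply: ApolyD; last exact: Apoly_mon.
rewrite mulr_sumr; apply: (Apoly_sum (f := fun i => (1 - t * b 0%N) * (a i * z ^+ i))) => i hi.
rewrite mulrA; apply: Apoly_mon => //; apply: ksubM => //; apply: ksubD; first exact: ksub1.
by apply: ksubN; apply: ksubM.
Qed.

(** Induction on n + m: the longer expression is shortened by [Apoly_descent], with z and 1/z
    exchanged if necessary. At most one term is impossible, as 1/t is nonzero and outside R. *)
Lemma Apoly_absurd z n m : z != 0 -> Apoly z n t^-1 -> Apoly z^-1 m t^-1 -> False.
Proof.
have zero y : Apoly y 0 t^-1 -> False.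
  move=> [a [_]]; rewrite big_ord0 => /eqP; rewrite invr_eq0; exact/negP/ksub_t_neq0.
have one y : Apoly y 1 t^-1 -> False.
  by move=> [a [ha]]; rewrite big_ord_recl big_ord0 addr0 expr0 mulr1 => E; apply: tVR; rewrite E.
have [k] := ubnP (n + m)%N; elim: k z n m => // k IH z [|[|n]] [|[|m]] hk z0 hn hm;
  try by first [exact: zero hn|exact: zero hm|exact: one hn|exact: one hm].
case: (leqP m n) => mn.
  apply: (IH z n.+1 m.+2 _ z0 _ hm); first by lia.
  exact: (Apoly_descent z0 _ _ hn hm).
apply: (IH z^-1 m.+1 n.+2); rewrite ?invr_eq0 ?invrK //; first by lia.
apply: (@Apoly_descent _ _ n.+1); rewrite ?invr_eq0 ?invrK //; lia.
Qed.

End Subring.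

Definition valuation_ring (R : F -> Prop) := ksubring R /\ forall z, R z \/ R z^-1.

(* A K-subring that is maximal among those containing t but not 1/t is a valuation ring. *)
Lemma valuation_ring_ex t : (forall p : {poly K}, p != 0 -> (map_poly iota p).[t] != 0) ->
  exists R, [/\ valuation_ring R, R t & ~ R t^-1].
Proof.
move=> tp.
pose good R := [/\ ksubring R, R t & ~ R t^-1].
pose Pr (R : F -> Prop) := (forall x, ~ R x) \/ good R.
have t0 : t != 0.
  by have := tp 'X; rewrite map_polyX hornerX polyX_eq0; apply.
pose R0 x := exists p : {poly K}, x = (map_poly iota p).[t].
have gR0 : good R0.
  split.
  - split=> [c|x y [p ->] [q ->]|x y [p ->] [q ->]].
    + by exists c%:P; rewrite map_polyC hornerC.
    + by exists (p + q); rewrite rmorphD hornerD.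
    + by exists (p * q); rewrite rmorphM hornerM.
  - by exists 'X; rewrite map_polyX hornerX.
  (* If 1/t = p(t), then t is a root of X p - 1, whose constant term is -1. *)
  - move=> [p Ep].
    have /tp/eqP : 'X * p - 1 != 0.
      apply/eqP => /(congr1 (fun q : {poly K} => q`_0)) /eqP.
      by rewrite coefB coefXM coef1 coef0 /= sub0r oppr_eq0 oner_eq0.
    by rewrite rmorphB rmorphM rmorph1 /= map_polyX !hornerE -Ep mulfV ?subrr.
have [|R [PR Rmax]] := @classical_sets.Zorn_bigcup F Pr.
  move=> C CP Ctot.
  case: (classic (exists2 X, C X & exists x, X x)) => [[X CX [x Xx]]|Hn]; last first.
    by left=> x [X CX Xx]; apply: Hn; exists X => //; exists x.
  have gX Y y : C Y -> Y y -> good Y by move=> /CP [/(_ y)|].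
  have [[h1 h2 h3] h4 h5] := gX _ _ CX Xx; right; split.
  - split=> [c|a b [Y CY Ya] [Z CZ Zb]|a b [Y CY Ya] [Z CZ Zb]]; first by exists X.
      case: (Ctot _ _ CY CZ) => sYZ; [exists Z|exists Y] => //.
        by have [[_ g2 _] _ _] := gX _ _ CZ Zb; apply: g2 => //; apply: sYZ.
      by have [[_ g2 _] _ _] := gX _ _ CY Ya; apply: g2 => //; apply: sYZ.
    case: (Ctot _ _ CY CZ) => sYZ; [exists Z|exists Y] => //.
      by have [[_ _ g2] _ _] := gX _ _ CZ Zb; apply: g2 => //; apply: sYZ.
    by have [[_ _ g2] _ _] := gX _ _ CY Ya; apply: g2 => //; apply: sYZ.
  - by exists X.
  - by move=> [Y CY Yt]; have [_ _] := gX _ _ CY Yt.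
have gR : good R.
  case: PR => // Re; exfalso; apply: (Rmax R0); last by right.
  split; first by move=> x /Re.
  by move=> h; apply: (Re 0); apply: h; exists 0; rewrite rmorph0 horner0.
have [hR Rt RtV] := gR.
(* For z outside R, the ring R[z] is strictly larger than R, so by maximality it contains 1/t. *)
have ext z : ~ R z -> exists n, Apoly R z n t^-1.
  move=> nz; apply: NNPP => Hn; pose S w := exists n, Apoly R z n w.
  apply: (Rmax S); last first.
    have Sc a : R a -> S a.
      by move=> ha; exists 1%N; rewrite -[a]mulr1 -(expr0 z); apply: (Apoly_mon hR).
    right; split=> //; last by apply: Sc.
    split=> [c|a b [n hn] [m hm]|a b [n hn] [m hm]].
    + by apply: Sc; apply: (ksub_iota hR).
    + by exists (n + m)%N; apply: (ApolyD hR); [apply: (Apoly_le hR) hn|apply: (Apoly_le hR) hm]; rewrite ?leq_addr ?leq_addl.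
    + by exists (n + m)%N; apply: (ApolyM hR).
  split=> [w hw|h]; first by exists 1%N; rewrite -[w]mulr1 -(expr0 z); apply: (Apoly_mon hR).
  by apply: nz; apply: h; exists 2; have := Apoly_mon hR z (ksub1 hR) (ltnSn 1); rewrite mul1r expr1.
exists R; split=> //; split=> // z.
case: (classic (R z)) => [|nz]; first by left.
right; apply: NNPP => nzV.
have z0 : z != 0 by apply/eqP => z0; apply: nz; rewrite z0; apply: ksub0.
have [n hn] := ext _ nz; have [m hm] := ext _ nzV.
exact: (Apoly_absurd hR Rt RtV z0 hn hm).
Qed.

End PlaceExistence.

(** * Discreteness of the valuation rings of a function field *)

Section ValuationRing.
Variables (K : finFieldType) (F : fieldType) (iota : {rmorphism K -> F}).
Hypothesis Hff : function_field iota.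
Variables (R : F -> Prop).
Hypothesis hV : valuation_ring iota R.
Let hR := hV.1.

(** The maximal ideal of the valuation ring R. The element 0 is listed apart because [0^-1 = 0]. *)
Definition nonunit x := x = 0 \/ ~ R x^-1.

Lemma nonunit_sub x : nonunit x -> R x.
Proof. by case=> [->|h]; [apply: (ksub0 hR)|case: (hV.2 x)]. Qed.
Lemma nonunitM a x : R a -> nonunit x -> nonunit (a * x).
Proof.
move=> ha; case: (eqVneq x 0) => [->|x0]; first by rewrite mulr0; left.
case: (eqVneq a 0) => [->|a0]; first by rewrite mul0r; left.
case=> [/eqP|h]; first by rewrite (negbTE x0).
right=> h2; apply: h; have := ksubM hR ha h2.
by rewrite invfM mulrA mulfV // mul1r.
Qed.
(** One of x/y and y/x lies in R, so the sum is an R-multiple of one of its terms. *)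
Lemma nonunitD x y : nonunit x -> nonunit y -> nonunit (x + y).
Proof.
case: (eqVneq x 0) => [->|x0]; first by rewrite add0r.
case: (eqVneq y 0) => [->|y0]; first by rewrite addr0.
move=> hx hy; case: (hV.2 (x / y)) => h.
  have -> : x + y = (x / y + 1) * y by rewrite mulrDl mul1r divfK.
  by apply: nonunitM => //; apply: (ksubD hR) => //; apply: (ksub1 hR).
rewrite invf_div in h; have -> : x + y = (1 + y / x) * x by rewrite mulrDl mul1r divfK.
by apply: nonunitM => //; apply: (ksubD hR) => //; apply: (ksub1 hR).
Qed.
Lemma nonunit1 : ~ nonunit 1.
Proof. by case=> [/eqP|]; rewrite ?oner_eq0 // invr1; apply; apply: (ksub1 hR). Qed.
Lemma nonunitN x : nonunit x -> nonunit (- x).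
Proof. by move=> hx; rewrite -mulN1r; apply: nonunitM => //; apply: (ksubN hR); apply: (ksub1 hR). Qed.

(* In a combination of the w i the term of least valuation dominates, so it is not divisible by x. *)
Lemma chain_xindep x s (w : nat -> F) : x != 0 -> nonunit x ->
  (forall i, (i < s)%N -> [/\ w i != 0, R (w i) & nonunit (x / w i)]) ->
  (forall i j, (i < j)%N -> (j < s)%N -> nonunit (w j / w i)) ->
  xindep iota x (fun i : 'I_s => w i).
Proof.
move=> x0 mx hw hij.
(* The independence criterion is used with O = R and I = x R. *)
apply: (@xindep_of_free _ _ _ R (fun z => R (z / x))) => //.
- exact: (ksub_subspace hR).
- split=> [|c a b ha hb]; first by rewrite mul0r; apply: (ksub0 hR).
  rewrite mulrDl -mulrA; apply: (ksubD hR) => //; apply: (ksubM hR) => //; exact: (ksub_iota hR).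
- move=> z hz; rewrite -[z](divfK x0); apply: (ksubM hR) => //; exact: nonunit_sub.
- by move=> z hz; rewrite mulrAC mulfV // mul1r.
- by move=> t; case: (hw t).
move=> c Hc; apply: NNPP => /not_all_ex_not [i0 /eqP ci0].
case: (@arg_minnP _ i0 (fun i => c i != 0) val ci0) => j cj jmin.
have c0 (l : 'I_s) : (l < j)%N -> c l = 0.
  by move=> lj; apply/eqP/negPn/negP => /jmin; rewrite leqNgt lj.
have [wj0 wjR xwj] := hw j (ltn_ord j).
(* The combination equals (c_j + mu) w_j with mu in the maximal ideal, so the first factor is a
   unit. Membership in x R would then put w_j / x in R. *)
pose mu := \sum_(l | l != j) iota (c l) * (w l / w j).
have mmu : nonunit mu.
  rewrite /mu; elim/big_ind: _ => [||l lj]; [by left|exact: nonunitD|].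
  have [lt|gt|E] := ltngtP l j; last by rewrite (val_inj E) eqxx in lj.
    by rewrite c0 // rmorph0 mul0r; left.
  by apply: nonunitM; [apply: (ksub_iota hR)|apply: hij].
have E : comb iota c (fun i : 'I_s => w i) = (iota (c j) + mu) * w j.
  rewrite /comb (bigD1 j) //= mulrDl /mu mulr_suml; congr (_ + _).
  by apply: eq_bigr => l _; rewrite -mulrA divfK.
have u : R (iota (c j) + mu)^-1.
  apply: NNPP => hu; apply: nonunit1.
  have -> : 1 = iota (c j)^-1 * ((iota (c j) + mu) - mu).
    by rewrite addrK -rmorphM mulVf ?rmorph1.
  apply: nonunitM; first exact: (ksub_iota hR).
  by apply: nonunitD; [right|apply: nonunitN].
have u0 : iota (c j) + mu != 0.
  apply/eqP => h; apply: nonunit1.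
  have -> : 1 = iota (c j)^-1 * (- mu).
    by move/eqP: h; rewrite addr_eq0 => /eqP <-; rewrite -rmorphM mulVf ?rmorph1.
  by apply: nonunitM; [apply: (ksub_iota hR)|apply: nonunitN].
case: xwj => [/eqP|]; first by rewrite mulf_eq0 invr_eq0 (negbTE x0) (negbTE wj0).
rewrite invf_div; apply; rewrite E in Hc.
by have := ksubM hR u Hc; rewrite !mulrA mulVf // mul1r.
Qed.

(** Otherwise every nonzero nonunit p has a nonunit z with p/z still a nonunit. Iterating from t
    yields arbitrarily long chains, which contradict the bound on K[t]-independent families. *)
Lemma uniformizer_ex t : t != 0 -> nonunit t -> exists p, [/\ p != 0, nonunit p & forall z, nonunit z -> R (z / p)].
Proof.
move=> t0 mt; apply: NNPP => Hn.
have next p : exists z, p != 0 -> nonunit p -> [/\ z != 0, nonunit z & nonunit (p / z)].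
  apply: NNPP => Hp; apply: Hn; exists p.
  have p0 : p != 0 by apply/negP => /eqP p0; apply: Hp; exists 0; rewrite p0 eqxx.
  have mp : nonunit p by apply: NNPP => mp; apply: Hp; exists 0.
  split=> // z mz; apply: NNPP => h; apply: Hp; exists z => _ _.
  have z0 : z != 0 by apply/eqP => z0; apply: h; rewrite z0 mul0r; apply: (ksub0 hR).
  by split=> //; right; rewrite invf_div.
have [nx nxP] := choice _ next.
pose u i := iter i nx t.
have uP i : u i != 0 /\ nonunit (u i).
  by elim: i => // i [h1 h2]; rewrite /u iterS; case: (nxP _ h1 h2).
have uS i : nonunit (u i / u i.+1) by have [h1 h2] := uP i; case: (nxP _ h1 h2).
have uu d i : nonunit (u i / u (i + d.+1)%N).
  elim: d i => [|d IH] i; first by rewrite addn1.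
  have -> : u i / u (i + d.+2)%N = (u i / u i.+1) * (u i.+1 / u (i.+1 + d.+1)%N).
    by rewrite mulrA divfK ?(uP _).1 // addSnnS.
  by apply: nonunitM => //; apply: nonunit_sub.
have uu' i j : (i < j)%N -> nonunit (u i / u j).
  by move=> ij; have := uu (j - i.+1)%N i; rewrite -subSn // subSS subnKC // ltnW.
have [M HM] := xindep_bound t Hff.
(* The chain is reversed because [chain_xindep] expects increasing valuations. It stops at u_1,
   since t = u_0 must stay strictly above every term. *)
suff /HM : xindep iota t (fun i : 'I_M.+1 => u (M.+1 - i)%N) by rewrite card_ord ltnn.
apply: (@chain_xindep t M.+1 (fun i => u (M.+1 - i)%N)) => // [i iM|i j ij jM]; last by apply: uu'; lia.
have [h1 h2] := uP (M.+1 - i)%N; split=> //; first exact: nonunit_sub.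
by rewrite -[t]/(u 0%N); apply: uu'; lia.
Qed.

Section Uniformizer.
Variable p : F.
Hypotheses (p0 : p != 0) (mp : nonunit p) (pP : forall z, nonunit z -> R (z / p)).

Definition vunit x := [/\ x != 0, R x & R x^-1].
Definition hasval x (k : int) := vunit (x / p ^ k).

Lemma vunitM x y : vunit x -> vunit y -> vunit (x * y).
Proof.
by move=> [a b c] [d e f]; split; rewrite ?mulf_neq0 // ?invfM; apply: (ksubM hR).
Qed.
Lemma vunitV x : vunit x -> vunit x^-1.
Proof. by move=> [a b c]; split; rewrite ?invr_eq0 ?invrK. Qed.
Lemma pz0 k : p ^ k != 0. Proof. exact: expfz_neq0. Qed.

Lemma hasvalM x y k l : hasval x k -> hasval y l -> hasval (x * y) (k + l).
Proof.
move=> hx hy; have := vunitM hx hy; rewrite /hasval expfzDr //.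
by have -> : x / p ^ k * (y / p ^ l) = x * y / (p ^ k * p ^ l) by rewrite invfM; ring.
Qed.
Lemma hasvalV x k : hasval x k -> hasval x^-1 (- k).
Proof. by move=> /vunitV; rewrite /hasval -invr_expz invf_div invrK mulrC. Qed.

(** If all x/p^k lay in R, the powers 1, p, ..., p^M would be K[x]-independent for every M. Hence
    some x/p^k leaves R, and the least such k is one more than the value of x. *)
Lemma hasval_ex_R x : x != 0 -> R x -> exists k, hasval x k.
Proof.
move=> x0 Rx.
have [k hk] : exists k, ~ R (x / p ^+ k).
  apply: NNPP => Hn; have h k : R (x / p ^+ k) by apply: NNPP => h; apply: Hn; exists k.
  have h2 k : nonunit (x / p ^+ k).
    have -> : x / p ^+ k = (x / p ^+ k.+1) * p by rewrite exprS invfM mulrA mulrAC divfK.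
    exact: nonunitM.
  have [M HM] := xindep_bound x Hff.
  suff /HM : xindep iota x (fun i : 'I_M.+1 => p ^+ i) by rewrite card_ord ltnn.
  apply: (@chain_xindep x M.+1 (fun i => p ^+ i)) => // [|i iM|i j ij jM].
    by have := h2 0%N; rewrite expr0 divr1.
    by split; rewrite ?expf_neq0 //; apply: (ksubX hR); apply: nonunit_sub.
  rewrite -expfB //; have -> : (j - i = (j - i.+1).+1)%N by lia.
  by rewrite exprSr; apply: nonunitM => //; apply: (ksubX hR); apply: nonunit_sub.
have : exists k, cb (~ R (x / p ^+ k)).
  by exists k; rewrite /cb; case: excluded_middle_informative.
have cbP (Q : Prop) : cb Q -> Q by rewrite /cb; case: excluded_middle_informative.
move=> ex; case: (ex_minnP ex) => -[|m] /cbP hm mmin.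
  by case: hm; rewrite expr0 divr1.
exists m%:Z; split; first by rewrite mulf_neq0 // invr_eq0 pz0.
  apply: NNPP => h; have : (m.+1 <= m)%N; last by rewrite ltnn.
  by apply: mmin; rewrite /cb; case: excluded_middle_informative.
apply: NNPP => h; apply: hm.
by rewrite exprSr invfM mulrA; apply: pP; right.
Qed.

Lemma hasval_ex x : x != 0 -> exists k, hasval x k.
Proof.
move=> x0; case: (hV.2 x) => h; first exact: hasval_ex_R.
have [|k hk] := hasval_ex_R _ h; first by rewrite invr_eq0.
by exists (- k); rewrite -[x]invrK; apply: hasvalV.
Qed.

Lemma hasval_ge0 x k : hasval x k -> R x -> 0 <= k.
Proof.
move=> [h1 h2 h3] hx; rewrite leNgt; apply/negP => k0.
have [n En] : exists n : nat, k = - n.+1%:Z by exists `|k|.-1%N; lia.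
have x0 : x != 0 by apply: contra h1 => /eqP ->; rewrite mul0r.
have hpk : R (p ^ k).
  by have := ksubM hR h3 hx; rewrite invf_div divfK.
rewrite En -invr_expz -exprnP in hpk.
case: mp => [/eqP|]; [by rewrite (negbTE p0)|apply].
have := ksubM hR (ksubX hR n (nonunit_sub mp)) hpk.
by rewrite exprS invfM mulrCA mulfV ?mulr1 ?expf_neq0.
Qed.

Lemma hasval_R x k : hasval x k -> 0 <= k -> R x.
Proof.
move=> [h1 h2 h3]; case: k h1 h2 h3 => // n h1 h2 h3 _.
rewrite -[x](divfK (pz0 n)); apply: (ksubM hR) => //; rewrite -exprnP.
by apply: (ksubX hR); apply: nonunit_sub.
Qed.

Lemma hasval_uniq x k l : hasval x k -> hasval x l -> k = l.
Proof.
move=> hk hl.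
have x0 : x != 0 by case: hk => h _ _; apply: contra h => /eqP ->; rewrite mul0r.
have h1 := hasvalM hk (hasvalV hl); have h2 := hasvalM hl (hasvalV hk).
rewrite mulfV // in h1 h2.
have := hasval_ge0 h1 (ksub1 hR); have := hasval_ge0 h2 (ksub1 hR); lia.
Qed.

Lemma hasval_add x y k l m : hasval x k -> hasval y l -> hasval (x + y) m -> Num.min k l <= m.
Proof.
move=> hx hy hxy.
have nr : hasval (p ^ Num.min k l)^-1 (- Num.min k l).
  apply: hasvalV; rewrite /hasval mulfV ?pz0 //.
  by split; rewrite ?oner_eq0 ?invr1 //; apply: (ksub1 hR).
have h1 := hasvalM hx nr; have h2 := hasvalM hy nr; have h3 := hasvalM hxy nr.
suff : 0 <= m - Num.min k l by rewrite subr_ge0.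
apply: (hasval_ge0 h3); rewrite mulrDl; apply: (ksubD hR).
  by apply: (hasval_R h1); rewrite subr_ge0 ge_min lexx.
by apply: (hasval_R h2); rewrite subr_ge0 ge_min lexx orbT.
Qed.

Definition vfun x : int := if x == 0 then 0 else epsilon (inhabits 0) (hasval x).
Lemma vfunP x : x != 0 -> hasval x (vfun x).
Proof. by move=> x0; rewrite /vfun ifN //; apply: epsilon_spec; apply: hasval_ex. Qed.
Lemma vfunE x k : hasval x k -> vfun x = k.
Proof.
move=> h; have x0 : x != 0 by case: h => h _ _; apply: contra h => /eqP ->; rewrite mul0r.
exact: hasval_uniq (vfunP x0) h.
Qed.

Lemma vfun_place : is_place iota vfun.
Proof.
split.
- by rewrite /vfun eqxx.
- by move=> x y x0 y0; apply: vfunE; apply: hasvalM; apply: vfunP.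
- by move=> x y x0 y0 xy0; apply: (hasval_add (vfunP x0) (vfunP y0)); apply: vfunP.
- move=> c c0; apply: vfunE; rewrite /hasval expr0z divr1.
  by split; rewrite ?fmorph_eq0 // -?fmorphV; apply: (ksub_iota hR).
- exists p; split=> //; apply: vfunE; rewrite /hasval expr1z mulfV //.
  by split; rewrite ?oner_eq0 ?invr1 //; apply: (ksub1 hR).
Qed.

Lemma vfun_nonunit x : x != 0 -> nonunit x -> 0 < vfun x.
Proof.
move=> x0 mx; have h := vfunP x0; rewrite lt_neqAle (hasval_ge0 h (nonunit_sub mx)) andbT.
apply/eqP => h0; rewrite -h0 in h; case: mx => [/eqP|]; first by rewrite (negbTE x0).
by apply; move: h => [_ _]; rewrite expr0z divr1.
Qed.

End Uniformizer.
End ValuationRing.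

(** As t is transcendental, some valuation ring has t as a nonunit; a uniformizer of that ring
    defines the normalized valuation. *)
Lemma place_above (K : finFieldType) (F : fieldType) (iota : {rmorphism K -> F}) (t : F) :
  function_field iota -> (forall c, t <> iota c) -> exists P : place iota, 0 < P t.
Proof.
move=> Hff ht; have [R [hV Rt RtV]] := valuation_ring_ex (transcendental Hff ht).
have t0 : t != 0 by apply/eqP => t0; apply: (ht 0); rewrite rmorph0.
have mt : nonunit R t by right.
have [p [p0 mp pP]] := uniformizer_ex Hff hV t0 mt.
have hp : is_place iota (vfun R p) by exact: (vfun_place Hff hV p0 mp pP).
exists (Place hp) => /=; exact: (vfun_nonunit Hff hV p0 mp pP).
Qed.

(** * Valuations and approximation *)

Lemma cbP (Q : Prop) : reflect Q (cb Q).
Proof. by rewrite /cb; case: excluded_middle_informative => h; constructor. Qed.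

(** Equality of places is decided by the same boolean as in [dcoef], so lists of places get
    membership and multiplicities. *)
Lemma place_eqP (K : finFieldType) (F : fieldType) (iota : {rmorphism K -> F}) :
  Equality.axiom (fun P Q : place iota => cb (P = Q)).
Proof. by move=> P Q; apply: cbP. Qed.
HB.instance Definition _ (K : finFieldType) (F : fieldType) (iota : {rmorphism K -> F}) :=
  hasDecEq.Build (place iota) (@place_eqP K F iota).

Section Valuations.
Variables (K : finFieldType) (F : fieldType) (iota : {rmorphism K -> F}).
Implicit Types (P Q : place iota).

Lemma pval0 P : P 0 = 0. Proof. by case: (pvalP P). Qed.
Lemma pvalM P x y : x != 0 -> y != 0 -> P (x * y) = P x + P y.
Proof. by case: (pvalP P) => _ h _ _ _; apply: h. Qed.
Lemma pval_iota P c : P (iota c) = 0.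
Proof.
case: (eqVneq c 0) => [->|c0]; first by rewrite rmorph0 pval0.
by case: (pvalP P) => _ _ _ h _; apply: h.
Qed.
Lemma pval1 P : P 1 = 0. Proof. by rewrite -(rmorph1 iota) pval_iota. Qed.
Lemma pvalV P x : P x^-1 = - P x.
Proof.
case: (eqVneq x 0) => [->|x0]; first by rewrite invr0 pval0.
have := @pvalM P x x^-1 x0; rewrite invr_eq0 mulfV // pval1 => /(_ x0); lia.
Qed.
Lemma pvalN P x : P (- x) = P x.
Proof.
case: (eqVneq x 0) => [->|x0]; first by rewrite oppr0.
by rewrite -mulN1r pvalM ?oppr_eq0 ?oner_eq0 // -(rmorphN1 iota) pval_iota add0r.
Qed.
Lemma pvalX P x n : x != 0 -> P (x ^+ n) = P x * n%:Z.
Proof.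
move=> x0; elim: n => [|n IH]; first by rewrite expr0 pval1 mulr0.
by rewrite exprS pvalM ?expf_neq0 // IH; lia.
Qed.
Lemma uniformizer P : exists t, t != 0 /\ P t = 1.
Proof. by case: (pvalP P). Qed.

(* P 0 = 0 is only a convention; the first disjunct restores the value +oo at 0. *)
Definition vge P (k : int) (x : F) := x = 0 \/ k <= P x.

Lemma vge0 P k : vge P k 0. Proof. by left. Qed.
Lemma vgeD P k x y : vge P k x -> vge P k y -> vge P k (x + y).
Proof.
case: (eqVneq x 0) => [->|x0]; first by rewrite add0r.
case: (eqVneq y 0) => [->|y0]; first by rewrite addr0.
case: (eqVneq (x + y) 0) => [->|xy0]; first by left.
case=> [/eqP|hx]; first by rewrite (negbTE x0).
case=> [/eqP|hy]; first by rewrite (negbTE y0).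
right; case: (pvalP P) => _ _ h _ _; apply: le_trans (h _ _ x0 y0 xy0).
by rewrite le_min hx hy.
Qed.
Lemma vgeM P k l x y : vge P k x -> vge P l y -> vge P (k + l) (x * y).
Proof.
case: (eqVneq x 0) => [->|x0]; first by rewrite mul0r; left.
case: (eqVneq y 0) => [->|y0]; first by rewrite mulr0; left.
case=> [/eqP|hx]; first by rewrite (negbTE x0).
case=> [/eqP|hy]; first by rewrite (negbTE y0).
by right; rewrite pvalM // lerD.
Qed.
Lemma vge_refl P x : vge P (P x) x. Proof. by right. Qed.
Lemma vge_le P k l x : k <= l -> vge P l x -> vge P k x.
Proof. by move=> kl [->|h]; [left|right; apply: le_trans h]. Qed.
Lemma vge_iota P c : vge P 0 (iota c). Proof. by right; rewrite pval_iota. Qed.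
Lemma vge_subspace P k : subspace iota (vge P k).
Proof.
split=> [|c x y hx hy]; first exact: vge0.
by apply: vgeD => //; rewrite -[k]add0r; apply: vgeM => //; apply: vge_iota.
Qed.
Lemma vgeB P k x y : vge P k x -> vge P k y -> vge P k (x - y).
Proof. exact: (subspaceB (vge_subspace P k)). Qed.
Lemma vgeZE P k z x : z != 0 -> vge P k (z * x) <-> vge P (k - P z) x.
Proof.
move=> z0; case: (eqVneq x 0) => [->|x0].
  by rewrite mulr0; split=> _; left.
split=> -[/eqP|h]; rewrite ?mulf_eq0 ?(negbTE z0) ?(negbTE x0) //; right;
  move: h; rewrite pvalM //; lia.
Qed.
(** The strict triangle inequality: if x + y had value above P x, so would x = (x + y) - y. *)
Lemma pval_dominant P x y : x != 0 -> vge P (P x + 1) y -> x + y != 0 /\ P (x + y) = P x.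
Proof.
move=> x0 hy.
have xy0 : x + y != 0.
  apply/eqP => /eqP; rewrite addr_eq0 => /eqP E; move: x0 hy; rewrite E oppr_eq0 pvalN.
  by move=> y0 [/eqP|]; [rewrite (negbTE y0)|lia].
split=> //; case: hy => [->|hy]; first by rewrite addr0.
have h1 : P x <= P (x + y).
  have [/eqP|//] : vge P (P x) (x + y); last by rewrite (negbTE xy0).
  by apply: vgeD; right; lia.
have h2 : ~ (P x + 1 <= P (x + y)).
  move=> h; have : vge P (P x + 1) (x + y - y) by apply: vgeB; right.
  by rewrite addrK => -[/eqP|]; [rewrite (negbTE x0)|lia].
lia.
Qed.

Lemma inmaxE P x : inmax P x <-> vge P 1 x.
Proof. by split=> -[->|h]; [left|right; lia|left|right; lia]. Qed.
Lemma inmax_subspace P : subspace iota (inmax P).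
Proof.
by split=> [|c x y /inmaxE hx /inmaxE hy]; [left|apply/inmaxE; apply: (vge_subspace P 1).2].
Qed.

(** If the ring of P were inside that of Q, elements of P-value 0 would have Q-value 0. So Q = Q(t)
    P for a uniformizer t of P, and normalization of Q forces Q(t) = 1. *)
Lemma place_incomparable P Q : P <> Q -> exists f, [/\ f != 0, 0 <= P f & Q f < 0].
Proof.
move=> PQ; apply: NNPP => Hn; apply: PQ.
have h f : f != 0 -> 0 <= P f -> 0 <= Q f.
  by move=> f0 hf; rewrite leNgt; apply/negP => hq; apply: Hn; exists f.
have unit f : f != 0 -> P f = 0 -> Q f = 0.
  move=> f0 pf; have := h f f0; have := h f^-1; rewrite !pvalV invr_eq0 pf => /(_ f0); lia.
have [t [t0 Pt]] := uniformizer P.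
have Qt : 0 <= Q t by apply: h; rewrite ?Pt.
have posE x : x != 0 -> 0 <= P x -> Q x = Q t * P x.
  move=> x0 px; have [n En] : exists n : nat, P x = n%:Z by exists `|P x|%N; lia.
  have tn0 : t ^- n != 0 by rewrite invr_eq0 expf_neq0.
  have := unit (x * t ^- n); rewrite mulf_neq0 // !pvalM // !pvalV !pvalX // Pt En.
  by rewrite mul1r subrr => /(_ isT erefl); lia.
have E x : Q x = Q t * P x.
  case: (eqVneq x 0) => [->|x0]; first by rewrite !pval0 mulr0.
  case: (lerP 0 (P x)) => px; first exact: posE.
  have := posE x^-1; rewrite invr_eq0 !pvalV => /(_ x0); lia.
have [s [_ Qs]] := uniformizer Q.
have Qt1 : Q t = 1.
  by move: (E s) Qt; rewrite Qs; move: (Q t) (P s) => a b; case: (lerP b 0) => hb; nia.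
have EPQ : P = Q :> (F -> int) by apply: functional_extensionality => x; rewrite E Qt1 mul1r.
case: P Q {Hn h unit Qt posE E Qs Pt Qt1} EPQ => p hp [q hq] /= E; subst q.
by rewrite (proof_irrelevance _ hp hq).
Qed.

(** The quotient of the two witnesses obtained from (P, Q) and from (Q, P). *)
Lemma place_separate P Q : P <> Q -> exists u, [/\ u != 0, 0 < P u & Q u < 0].
Proof.
move=> PQ; have [f [f0 Pf Qf]] := place_incomparable PQ.
have [g [g0 Qg Pg]] := place_incomparable (not_eq_sym PQ).
exists (f / g); rewrite mulf_neq0 ?invr_eq0 // !pvalM ?invr_eq0 // !pvalV; split=> //; lia.
Qed.

(** Induction on S: when u has no pole at the new place Q, a high power of an element separating P
    from Q is added to u. *)
Lemma place_separate_seq P (S : seq (place iota)) : P \notin S ->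
  exists u, [/\ u != 0, 0 < P u & forall Q, Q \in S -> Q u < 0].
Proof.
elim: S => [_|Q S IH].
  by have [t [t0 Pt]] := uniformizer P; exists t; split=> //; rewrite Pt.
rewrite inE negb_or => /andP[/eqP PQ /IH [u [u0 Pu Su]]].
case: (ltrP (Q u) 0) => [Qu|Qu].
  by exists u; split=> // R; rewrite inE => /orP[/eqP ->|/Su].
have [w [w0 Pw Qw]] := place_separate PQ.
(* The exponent exceeds every |R u|, so w^r and u have different values at each R in S and the
   smaller one decides the sum. *)
pose r := (\sum_(R <- S) `|R u|%N).+1.
have rS R : R \in S -> R w * r%:Z != R u.
  move=> hR; have hr : (`|R u| < r)%N by rewrite ltnS (big_rem R hR) leq_addr.
  apply/eqP => E; move: hr (Su _ hR); rewrite -E abszM.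
  by case: (eqVneq (R w) 0) => [->|hw]; rewrite ?mul0r //; nia.
have wr0 : w ^+ r != 0 by rewrite expf_neq0.
have Qwr : Q (w ^+ r) < 0 by rewrite pvalX // /r; nia.
have hlt (R : place iota) : R (w ^+ r) < 0 -> R (w ^+ r) < R u -> u + w ^+ r != 0 /\ R (u + w ^+ r) < 0.
  move=> h1 h2; rewrite addrC; have [|-> ->] := @pval_dominant R (w ^+ r) u wr0 => //.
  by right; lia.
have [uw0 Quw] := hlt Q Qwr (lt_le_trans Qwr Qu).
exists (u + w ^+ r); split=> //.
  have [/eqP|h] : vge P 1 (u + w ^+ r); [|by rewrite (negbTE uw0)|by lia].
  by apply: vgeD; right; [lia|rewrite pvalX // /r; nia].
move=> R; rewrite inE => /orP[/eqP ->//|hR].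
have := rS _ hR; rewrite -pvalX // neq_lt => /orP[h|h].
  by have [] := hlt R (lt_trans h (Su _ hR)) h.
have [|_ ->] := @pval_dominant R u (w ^+ r) u0; last exact: Su.
by right; lia.
Qed.

(** The element 1 / (1 + u^(M+1)) is close to 1 at a zero of u and small at the poles of u. *)
Lemma place_approx1 P (S : seq (place iota)) (M : nat) : P \notin S ->
  exists e, vge P 1 (e - 1) /\ forall Q, Q \in S -> vge Q M%:Z e.
Proof.
case/place_separate_seq => u [u0 Pu Su].
pose x := u ^+ M.+1.
have x0 : x != 0 by rewrite expf_neq0.
have Px : 0 < P x by rewrite pvalX //; nia.
have [x1 Px1] : 1 + x != 0 /\ P (1 + x) = P 1.
  by apply: pval_dominant; [exact: oner_neq0|right; rewrite pval1; lia].
exists (1 + x)^-1; split.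
  have -> : (1 + x)^-1 - 1 = - x / (1 + x) by field.
  by right; rewrite pvalM ?oppr_eq0 ?invr_eq0 // pvalN pvalV Px1 pval1; lia.
move=> Q /Su Qu; right; rewrite pvalV addrC.
have Qx : Q x <= - M.+1%:Z by rewrite pvalX //; nia.
by have [|_ ->] := @pval_dominant Q x 1 x0; [right; rewrite pval1|]; lia.
Qed.

End Valuations.

(** * Finiteness of residue fields, and independent families built from zeros *)

Section Degrees.
Variables (K : finFieldType) (F : fieldType) (iota : {rmorphism K -> F}).
Hypothesis Hff : function_field iota.
Implicit Types (P Q : place iota).

Lemma inval_subspace P : subspace iota (inval P).
Proof. exact: vge_subspace. Qed.

(** Elements independent in the residue field are K[t]-independent for a uniformizer t, hence
    bounded in number. So the choice made in [pdeg] is meaningful. *)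
Lemma pdegP P : is_pdeg P (pdeg P).
Proof.
apply: epsilon_spec; have [t [t0 Pt]] := uniformizer P.
have [M HM] := xindep_bound t Hff.
suff [r _ hr] : exists2 r, (r <= M)%N & rdim iota (inval P) (inmax P) r by exists r.
apply: free_rdim_ex; first exact: inmax_subspace.
move=> r f fV ff; rewrite -(card_ord r).
apply: HM; apply: (xindep_of_free t0 (inval_subspace P) (inmax_subspace P) _ _ fV ff).
  by move=> w [->|h]; [left|right; lia].
by move=> w hw; apply/inmaxE; rewrite -[1]addr0; apply: vgeM hw; right; rewrite Pt.
Qed.

Lemma pdeg_gt0 P : (0 < pdeg P)%N.
Proof.
have := free_rdim_le (inmax_subspace P) (pdegP P) (g := fun _ : unit => 1).
rewrite card_unit; apply; first by right; rewrite pval1.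
move=> c; rewrite /comb (bigD1 tt) //= big_pred0_eq addr0 mulr1 => -[/eqP|].
  by rewrite fmorph_eq0 => /eqP c0 [].
by rewrite pval_iota.
Qed.

(** Induction on the multiset s. If P already occurs a times, a new copy contributes the elements e
    y_j t0^a, where the y_j form a residue basis, t0 is a uniformizer, and e is close to 1 at P and
    small at the other places of S. *)
Lemma places_in_free (s : seq (place iota)) (S : seq (place iota)) : {subset s <= S} ->
  exists (T : finType) (f : T -> F), [/\ #|T| = (\sum_(P <- s) pdeg P)%N,
   forall t Q, Q \in S -> vge Q 0 (f t) &
   free_mod iota (fun x => forall Q, Q \in S -> vge Q (count_mem Q s)%:Z x) f].
Proof.
elim: s => [|P s IH] sS.
  exists void, (fun x : void => match x with end); rewrite big_nil card_void.
  by split=> // -[].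
have [|T [f [cT fO ff]]] := IH; first by move=> Q hQ; apply: sS; rewrite inE hQ orbT.
have [y [yV [yf _]]] := pdegP P.
have [t0 [t00 Pt0]] := uniformizer P; pose a := count_mem P s; pose t := t0 ^+ a.
have tn0 : t != 0 by rewrite expf_neq0.
have Pt : P t = a%:Z by rewrite pvalX // Pt0 mul1r.
pose S' := [seq Q <- S | Q != P].
(* Large enough to absorb any pole of the y_j t on S and still leave order [size s], which is at
   least every multiplicity in s. *)
pose M := (\sum_(Q <- S) \sum_(j < pdeg P) `|Q (y j * t)%R| + size s)%N.
have PS' : P \notin S' by rewrite mem_filter eqxx.
have [e [eP eS]] := place_approx1 M PS'.
pose z j := e * (y j * t).
have zS Q j : Q \in S -> Q <> P -> vge Q (size s)%:Z (z j).
  move=> QS /eqP QP; have QS' : Q \in S' by rewrite mem_filter QP.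
  apply: vge_le (vgeM (eS _ QS') (vge_refl Q (y j * t))).
  have : (`|Q (y j * t)%R| <= \sum_(Q <- S) \sum_(j < pdeg P) `|Q (y j * t)%R|)%N.
    by rewrite (big_rem Q QS) (bigD1 j) //= -addnA leq_addr.
  rewrite /M; lia.
have zP j : vge P (a%:Z + 1) (z j - y j * t).
  have -> : z j - y j * t = (e - 1) * (y j * t) by rewrite mulrBl mul1r.
  rewrite addrC; apply: vgeM => //; rewrite -[a%:Z]add0r; apply: vgeM; first exact: yV.
  by right; rewrite Pt.
have ytP j : vge P a%:Z (y j * t).
  by rewrite -[a%:Z]add0r; apply: vgeM; [exact: yV|right; rewrite Pt].
have zPa j : vge P a%:Z (z j).
  rewrite -[z j](subrK (y j * t)); apply: vgeD => //; apply: vge_le (zP j); lia.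
pose g (i : T + 'I_(pdeg P)) := match i with inl i => f i | inr j => z j end.
exists (T + 'I_(pdeg P))%type, g; split.
- by rewrite card_sum cT card_ord big_cons addnC.
- move=> [i|j] Q QS /=; first exact: fO.
  case: (classic (Q = P)) => [->|QP]; first by apply: vge_le (zPa j).
  by apply: vge_le (zS Q j QS QP).
- move=> c Hc.
  have hz Q : Q \in S -> vge Q (count_mem Q s)%:Z (comb iota (fun j => c (inr j)) z).
    move=> QS; apply: subspace_comb; first exact: vge_subspace.
    move=> j; case: (classic (Q = P)) => [->//|QP].
    by apply: vge_le (zS Q j QS QP); rewrite lez_nat count_size.
  (* The new elements already vanish to the orders prescribed by s, so they do not affect the
     relation for the old family. *)
  have c1 : forall i, c (inl i) = 0.
    apply: (ff (fun i => c (inl i))) => Q QS.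
    have -> : comb iota (fun i => c (inl i)) f = comb iota c g - comb iota (fun j => c (inr j)) z.
      by rewrite [comb iota c g]comb_sum /= addrK.
    apply: vgeB; last exact: hz.
    by apply: vge_le (Hc Q QS) => /=; lia.
  have E0 : comb iota (fun i => c (inl i)) f = 0.
    by rewrite /comb big1 // => i _; rewrite c1 rmorph0 mul0r.
  have := Hc P (sS _ (mem_head _ _)); rewrite comb_sum /= E0 add0r eqxx => hP.
  have c2 : forall j, c (inr j) = 0; last by case.
  apply: (yf (fun j => c (inr j))); apply/inmaxE.
  (* Replacing e by 1 changes nothing modulo order a + 1 at P; dividing by t then leaves a relation
     between residue classes of the y_j. *)
  have : vge P (a%:Z + 1) (comb iota (fun j => c (inr j)) (fun j => y j * t)).
    have -> : comb iota (fun j => c (inr j)) (fun j => y j * t) =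
       comb iota (fun j => c (inr j)) z - comb iota (fun j => c (inr j)) (fun j => z j - y j * t).
      by rewrite /comb -sumrB; apply: eq_bigr => j _; rewrite -mulrBr subKr.
    apply: vgeB; first by apply: vge_le hP; rewrite PoszD addrC lexx.
    by apply: subspace_comb => //; apply: vge_subspace.
  have -> : comb iota (fun j => c (inr j)) (fun j => y j * t) = t * comb iota (fun j => c (inr j)) y.
    by rewrite -comb_scale; apply: eq_comb => // j; rewrite mulrC.
  by move/(vgeZE _ _ _ tn0); rewrite Pt addrAC subrr add0r.
Qed.

(** Here O consists of the functions regular on s and I of those vanishing there with multiplicity.
    The orders of x give x O inside I. *)
Lemma zeros_xindep x (s : seq (place iota)) : x != 0 ->
  (forall P, P \in s -> (count_mem P s)%:Z <= P x) ->
  exists (T : finType) (f : T -> F), #|T| = (\sum_(P <- s) pdeg P)%N /\ xindep iota x f.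
Proof.
move=> x0 hx; have [T [f [cT fO ff]]] := places_in_free (fun P (h : P \in s) => h).
exists T, f; split=> //.
apply: (@xindep_of_free _ _ _ (fun w => forall Q, Q \in s -> vge Q 0 w) _ _ _ _ x0 _ _ _ _ _ ff) => //.
- split=> [Q _|c u v hu hv Q Qs]; first exact: vge0.
  by apply: (vge_subspace Q 0).2; auto.
- split=> [Q _|c u v hu hv Q Qs]; first exact: vge0.
  by apply: (vge_subspace Q _).2; auto.
- by move=> w hw Q /hw; apply: vge_le.
- move=> w hw Q Qs; rewrite -[_%:Z]addr0; apply: vgeM; last exact: hw.
  by right; apply: hx.
Qed.

End Degrees.

(** * Divisors and Riemann's theorem *)

Section Divisors.
Variables (K : finFieldType) (F : fieldType) (iota : {rmorphism K -> F}).
Implicit Types (P Q : place iota) (A B C Z : divisor iota).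

Lemma dcoefE A P : dcoef A P = \sum_(x <- A) (if x.1 == P then x.2 else 0).
Proof. by []. Qed.
Lemma dcoef_nil P : dcoef [::] P = 0. Proof. by rewrite dcoefE big_nil. Qed.
Lemma ddeg_nil : ddeg ([::] : divisor iota) = 0. Proof. by rewrite /ddeg big_nil. Qed.
Lemma dcoef_cat A B P : dcoef (A ++ B) P = dcoef A P + dcoef B P.
Proof. by rewrite !dcoefE big_cat. Qed.
Lemma ddeg_cat A B : ddeg (A ++ B) = ddeg A + ddeg B.
Proof. by rewrite /ddeg big_cat. Qed.

Definition dscale (l : int) A : divisor iota := [seq (x.1, l * x.2) | x <- A].
Lemma dcoef_scale l A P : dcoef (dscale l A) P = l * dcoef A P.
Proof.
rewrite !dcoefE big_map mulr_sumr; apply: eq_bigr => x _ /=.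
by case: ifP => // _; rewrite mulr0.
Qed.
Lemma ddeg_scale l A : ddeg (dscale l A) = l * ddeg A.
Proof. by rewrite /ddeg big_map mulr_sumr; apply: eq_bigr => x _; rewrite mulrA. Qed.

Definition dsum (s : seq (place iota)) : divisor iota := [seq (P, 1) | P <- s].
Lemma dcoef_dsum s P : dcoef (dsum s) P = (count_mem P s)%:Z.
Proof.
rewrite dcoefE big_map; elim: s => [|Q s IH]; first by rewrite big_nil.
by rewrite big_cons IH /=; case: eqP.
Qed.
Lemma ddeg_dsum s : ddeg (dsum s) = (\sum_(P <- s) pdeg P)%N%:Z.
Proof.
rewrite /ddeg big_map; elim: s => [|Q s IH]; first by rewrite !big_nil.
by rewrite !big_cons IH mul1r.
Qed.

Definition dgraph (h : place iota -> int) (S : seq (place iota)) : divisor iota :=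
  [seq (P, h P) | P <- S].
Lemma dcoef_graph h S P : uniq S -> dcoef (dgraph h S) P = if P \in S then h P else 0.
Proof.
rewrite dcoefE big_map; elim: S => [|Q S IH] /=; first by rewrite big_nil.
move=> /andP[QS /IH E]; rewrite big_cons E inE /= [P == Q]eq_sym.
by case: eqP QS => [->|_] QS /=; rewrite ?(negbTE QS) ?addr0 ?add0r.
Qed.

Lemma ddegE A (S : seq (place iota)) : uniq S -> (forall x, x \in map fst A -> x \in S) ->
  ddeg A = \sum_(Q <- S) dcoef A Q * (pdeg Q)%:Z.
Proof.
move=> uS hS; under eq_bigr do rewrite dcoefE mulr_suml.
rewrite exchange_big /=; elim: A hS => [|x A IH] hS; first by rewrite ddeg_nil big_nil.
rewrite big_cons /ddeg big_cons -/(ddeg A) IH; last first.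
  by move=> y hy; apply: hS; rewrite inE hy orbT.
congr (_ + _); rewrite (bigD1_seq x.1) //=; last by apply: hS; rewrite mem_head.
rewrite eqxx big1 ?addr0 // => Q Qx.
by rewrite eq_sym (negbTE Qx) mul0r.
Qed.

Definition effective A := forall P, 0 <= dcoef A P.

(** A divisor list may contain repeated or cancelling entries; an effective one is replaced by a
    multiset of places. *)
Lemma effective_seq A : effective A -> exists s : seq (place iota),
  (forall P, dcoef A P = (count_mem P s)%:Z) /\ ddeg A = (\sum_(P <- s) pdeg P)%N%:Z.
Proof.
move=> hA; pose S := undup (map fst A).
have S0 P : P \notin S -> dcoef A P = 0.
  rewrite mem_undup => hP; rewrite dcoefE big_seq big1 // => x xA.
  by case: eqP => // E; case/negP: hP; rewrite -E map_f.
exists (flatten [seq nseq `|dcoef A Q| Q | Q <- S]); split=> [P|].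
  rewrite count_flatten -map_comp sumnE big_map.
  case: (boolP (P \in S)) => [PS|PS].
    rewrite (bigD1_seq P) ?undup_uniq //= count_nseq /= eqxx mul1n big1 ?addn0.
      by have := hA P; lia.
    by move=> Q QP; rewrite count_nseq /= (negbTE QP).
  rewrite S0 // big_seq big1 // => Q QS; rewrite /= count_nseq /=.
  by case: eqP => // E; rewrite -E QS in PS.
rewrite (@ddegE A S) ?undup_uniq //; last by move=> x; rewrite mem_undup.
rewrite big_flatten big_map /=; elim: S {S0} => [|Q S IH]; first by rewrite !big_nil.
rewrite !big_cons IH PoszD; congr (_ + _); rewrite big_nseq iter_addn_0 PoszM mulrC.
by have := hA Q; lia.
Qed.

Lemma dcoef_bound A : exists s : seq (place iota), forall P, dcoef A P <= (count_mem P s)%:Z.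
Proof.
exists (flatten [seq nseq `|dcoef A P| P | P <- undup (map fst A)]) => P.
rewrite count_flatten -map_comp sumnE big_map.
case: (boolP (P \in map fst A)) => [PS|PS].
  by rewrite (bigD1_seq P) ?undup_uniq ?mem_undup //= count_nseq /= eqxx mul1n; lia.
rewrite dcoefE big_seq big1 // => x xA.
by case: eqP => // E; case/negP: PS; rewrite -E map_f.
Qed.

Lemma ddeg_le A B : (forall P, dcoef A P <= dcoef B P) -> ddeg A <= ddeg B.
Proof.
move=> h; have [|s [_]] := @effective_seq (B ++ dscale (-1) A).
  by move=> P; rewrite dcoef_cat dcoef_scale mulN1r subr_ge0.
rewrite ddeg_cat ddeg_scale; lia.
Qed.
Lemma eq_ddeg A B : (forall P, dcoef A P = dcoef B P) -> ddeg A = ddeg B.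
Proof. by move=> h; apply/eqP; rewrite eq_le !ddeg_le // => P; rewrite h. Qed.

(** An arbitrary coefficient function, rather than a list, makes it easy to raise one coefficient at
    a time. *)
Definition Lf (a : place iota -> int) (f : F) := forall P, vge P (- a P) f.

Lemma LspaceE A f : Lspace A f <-> Lf (dcoef A) f.
Proof.
split=> [[->|h] P|h]; [by left|by right|].
by case: (eqVneq f 0) => [|f0]; [left|right=> P; case: (h P) => // /eqP; rewrite (negbTE f0)].
Qed.
Lemma Lf_subspace a : subspace iota (Lf a).
Proof.
split=> [P|c x y hx hy P]; first by left.
by apply: (vge_subspace P _).2.
Qed.
Lemma Lspace_subspace A : subspace iota (Lspace A).
Proof.
split=> [|c x y /LspaceE hx /LspaceE hy]; first by left.
by apply/LspaceE; apply: (Lf_subspace _).2.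
Qed.
Lemma Lf_le a b f : (forall P, a P <= b P) -> Lf a f -> Lf b f.
Proof. by move=> ab h P; apply: vge_le (h P); rewrite lerN2. Qed.

Lemma pval_surj P k : exists t, t != 0 /\ P t = k.
Proof.
have [t [t0 Pt]] := uniformizer P.
case: (lerP 0 k) => hk; [exists (t ^+ `|k|)|exists (t ^- `|k|)];
  rewrite ?invr_eq0 expf_neq0 // ?pvalV pvalX // Pt; split=> //; lia.
Qed.

Lemma rdim_ext V V' W r : (forall x, V x <-> V' x) -> rdim iota V W r -> rdim iota V' W r.
Proof.
by move=> E [f [fV [ff fs]]]; exists f; split; [|split=> // g /E /fs //] => i; apply/E.
Qed.

(** * The spaces L(A), principal divisors, Riemann's theorem and gonality *)

Section Riemann.
Hypothesis Hff : function_field iota.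

(** Multiplication by an element of value a(P) + 1 at P embeds L(a + P)/L(a) into the residue field
    of P. *)
Lemma Lf_step a P r : rdim iota (Lf a) zero_only r ->
  exists r', rdim iota (Lf (fun Q => a Q + (P == Q)%:Z)) zero_only r' /\ (r <= r' <= r + pdeg P)%N.
Proof.
move=> hr; set b := fun Q => _.
have ab Q : a Q <= b Q by rewrite /b; lia.
have [k hk hd] : exists2 k, (k <= pdeg P)%N & rdim iota (Lf b) (Lf a) k.
  apply: free_rdim_ex; first exact: Lf_subspace.
  move=> k f fV ff; have [t [t0 Pt]] := pval_surj P (a P + 1).
  rewrite -(card_ord k).
  apply: (free_rdim_le (inmax_subspace P) (pdegP Hff P) (g := fun i => t * f i)).
    move=> i; have := vgeM (vge_refl P t) (fV i P); rewrite Pt /b eqxx.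
    by have -> : a P + 1 + - (a P + true) = 0 by lia.
  move=> c; rewrite comb_scale => /inmaxE /(vgeZE _ _ _ t0); rewrite Pt => h.
  apply: ff => Q; case: (eqVneq P Q) => [<-|PQ].
    by apply: vge_le h; lia.
  have := subspace_comb c (Lf_subspace b) fV Q.
  by rewrite /b (negbTE PQ) addr0.
exists (k + r)%N; split; last by rewrite leq_addl addnC leq_add2l.
apply: (rdim_add (Lf_subspace a) (subspace0 iota)) hd hr.
  by move=> x ->; case: (Lf_subspace a).
by move=> x; apply: Lf_le.
Qed.

Lemma Lf_seq a (s : seq (place iota)) r : rdim iota (Lf a) zero_only r ->
  exists r', rdim iota (Lf (fun Q => a Q + (count_mem Q s)%:Z)) zero_only r' /\
    (r <= r' <= r + \sum_(P <- s) pdeg P)%N.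
Proof.
elim: s a r => [|P s IH] a r hr.
  exists r; rewrite big_nil addn0 leqnn; split=> //; apply: rdim_ext hr => x.
  by split; apply: Lf_le => Q /=; rewrite addr0.
have [r1 [h1 /andP[le1 le2]]] := Lf_step P hr.
have [r2 [h2 /andP[le3 le4]]] := IH _ _ h1.
exists r2; rewrite big_cons; split; last by lia.
by apply: rdim_ext h2 => x; split; apply: Lf_le => Q /=; rewrite PoszD addrA.
Qed.

(** If f is not constant, neither is 1/f, and a zero of 1/f is a pole of f. *)
Lemma Lf0_const f : Lf (fun=> 0) f <-> exists c, f = iota c.
Proof.
split=> [hf|[c ->] P]; last by right; rewrite oppr0 pval_iota.
apply: NNPP => Hn; have hc c : f^-1 <> iota c.
  by move=> E; apply: Hn; exists c^-1; rewrite fmorphV -E invrK.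
have [P] := place_above Hff hc; rewrite pvalV => hP.
by case: (hf P) => [f0|]; [apply: Hn; exists 0; rewrite rmorph0|lia].
Qed.

Lemma rdim_Lf0 : rdim iota (Lf (fun=> 0)) zero_only 1.
Proof.
rewrite -card_unit; apply: (@rdim_card _ _ _ _ _ _ (fun _ => 1)).
- by move=> _; apply/Lf0_const; exists 1; rewrite rmorph1.
- move=> c; rewrite /zero_only /comb (bigD1 tt) //= big_pred0_eq addr0 mulr1 => /eqP.
  by rewrite fmorph_eq0 => /eqP c0 [].
- move=> g /Lf0_const [c ->]; exists (fun=> c).
  by rewrite /zero_only /comb (bigD1 tt) //= big_pred0_eq addr0 mulr1 subrr.
Qed.

(** L(A) lies in L of a sum of places, which is reached from the constants by finitely many steps of
    bounded growth. *)
Lemma ellP A : rdim iota (Lspace A) zero_only (ell A).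
Proof.
apply/is_dimE; apply: epsilon_spec.
have [s hs] := dcoef_bound A.
have [r [hr _]] := Lf_seq s rdim_Lf0.
have hA x : Lspace A x -> Lf (fun P => 0 + (count_mem P s)%:Z) x.
  by move/LspaceE; apply: Lf_le => P; rewrite add0r hs.
by have [k _ hk] := rdim_sub (subspace0 iota) hA hr; exists k; apply/is_dimE.
Qed.

Lemma ell_mono A B : (forall P, dcoef A P <= dcoef B P) ->
  (ell A <= ell B)%N /\ (ell B)%:Z <= (ell A)%:Z + (ddeg B - ddeg A).
Proof.
move=> h; have [|s [hs ds]] := @effective_seq (B ++ dscale (-1) A).
  by move=> P; rewrite dcoef_cat dcoef_scale mulN1r subr_ge0.
have [r [hr rle]] := Lf_seq s (rdim_ext (LspaceE A) (ellP A)).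
have -> : ell B = r.
  apply: (rdim_uniq (subspace0 iota) (ellP B)); apply: rdim_ext hr => x.
  rewrite LspaceE; have E P : dcoef A P + (count_mem P s)%:Z = dcoef B P.
    by rewrite -hs dcoef_cat dcoef_scale; lia.
  by split; apply: Lf_le => P; rewrite E.
move: ds rle; rewrite ddeg_cat ddeg_scale; lia.
Qed.

Lemma eq_ell A B : (forall P, dcoef A P = dcoef B P) -> ell A = ell B.
Proof. by move=> h; apply/eqP; rewrite eqn_leq !(ell_mono _).1 // => P; rewrite h. Qed.

Lemma ell_nil : ell ([::] : divisor iota) = 1%N.
Proof.
apply: (rdim_uniq (subspace0 iota) (ellP _)); apply: rdim_ext rdim_Lf0 => x.
by rewrite LspaceE; split; apply: Lf_le => P; rewrite dcoef_nil.
Qed.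

Lemma ell_effective A : effective A -> (ell A)%:Z <= ddeg A + 1.
Proof.
move=> hA; have [|_] := @ell_mono [::] A; first by move=> P; rewrite dcoef_nil.
rewrite ell_nil ddeg_nil; lia.
Qed.

Lemma ell_gt0 A : (0 < ell A)%N -> exists2 f, f != 0 & Lspace A f.
Proof.
move=> h; have [f [fV [ff _]]] := ellP A; pose i := Ordinal h; exists (f i) => //.
apply/eqP => fi0; have := ff (fun j => (j == i)%:R).
by rewrite /zero_only comb_delta => /(_ fi0 i)/eqP; rewrite eqxx oner_eq0.
Qed.

Definition is_zdiv x Z := forall P, dcoef Z P = Num.max 0 (P x).
Definition is_div x Z := forall P, dcoef Z P = P x.

(** Distinct zeros of x yield a K[x]-independent family at least as large as their number, so a
    longest list of zeros exists and contains them all. *)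
Lemma zdiv_ex x : x != 0 -> exists Z, is_zdiv x Z.
Proof.
move=> x0; have [M HM] := xindep_bound x Hff.
pose ok (S : seq (place iota)) := uniq S /\ forall P, P \in S -> 0 < P x.
pose Pr k := exists2 S, ok S & size S = k.
have Pr0 : Pr 0%N by exists [::].
have PrM k : Pr k -> (k <= M)%N.
  move=> [S [uS hS] <-].
  have [|T [f [cT /HM]]] := zeros_xindep (iota := iota) Hff (s := S) x0.
    by move=> P PS; rewrite count_uniq_mem // PS; have := hS P PS; lia.
  rewrite cT; apply: leq_trans; rewrite -sum1_size; apply: leq_sum => P _; exact: pdeg_gt0.
have [k [S [uS hS] Sk] kmax] := ex_maxP Pr0 PrM.
exists (dgraph (fun P => P x) S) => P; rewrite dcoef_graph //.
case: ifP => [/hS PS|PS]; first by rewrite max_r // ltW.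
case: (lerP (P x) 0) => [|hP] //.
suff /kmax : Pr k.+1 by rewrite ltnn.
exists (P :: S); last by rewrite /= Sk.
split; first by rewrite /= PS.
by move=> Q; rewrite inE => /orP[/eqP ->|/hS].
Qed.

Lemma div_ex x : x != 0 -> exists Z, is_div x Z.
Proof.
move=> x0; have [Z hZ] := zdiv_ex x0.
have [|Y hY] := @zdiv_ex x^-1; first by rewrite invr_eq0.
exists (Z ++ dscale (-1) Y) => P; rewrite dcoef_cat dcoef_scale hZ hY pvalV; lia.
Qed.

Lemma pole_bound (us : seq F) : exists C, effective C /\
  forall u, u \in us -> forall P, vge P (- dcoef C P) u.
Proof.
elim: us => [|u us [C [C0 hC]]]; first by exists [::]; split=> // P; rewrite dcoef_nil.
case: (eqVneq u 0) => [->|u0].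
  by exists C; split=> // w; rewrite inE => /orP[/eqP -> P|/hC //]; left.
have [|Y hY] := @zdiv_ex u^-1; first by rewrite invr_eq0.
exists (C ++ Y); split=> [P|w]; first by rewrite dcoef_cat hY; have := C0 P; lia.
rewrite inE => /orP[/eqP ->|hw] P.
  by right; rewrite dcoef_cat hY pvalV; have := C0 P; lia.
by apply: vge_le (hC _ hw P); rewrite dcoef_cat hY; lia.
Qed.

(** With C bounding the poles of the u_t, the products x^-j u_t for j <= l lie in L(l Z + C). *)
Lemma ell_multiples x Z (T : finType) (u : T -> F) : x != 0 -> is_zdiv x Z -> xindep iota x u ->
  exists C, effective C /\ forall l : nat, (#|T| * l.+1 <= ell (dscale l%:Z Z ++ C))%N.
Proof.
move=> x0 hZ xu; have [C [C0 hC]] := pole_bound [seq u t | t : T].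
exists C; split=> // l.
have := free_rdim_le (subspace0 iota) (ellP (dscale l%:Z Z ++ C))
  (g := fun tj : T * 'I_l.+1 => x^-1 ^+ tj.2 * u tj.1).
rewrite card_prod card_ord; apply; last exact: xindep_inv.
move=> [t j]; apply/LspaceE => P /=.
have hu : vge P (- dcoef C P) (u t) by apply: hC; apply: map_f; rewrite mem_enum.
rewrite dcoef_cat dcoef_scale hZ.
apply: vge_le (vgeM (vge_refl P (x^-1 ^+ j)) hu).
rewrite pvalX ?invr_eq0 // pvalV.
have jl : (j%:Z <= l%:Z) by have := ltn_ord j; lia.
by case: (lerP 0 (P x)) => h; nia.
Qed.

(** For all l, #|T| (l + 1) <= ell(l Z + C) <= l deg Z + deg C + 1; the growth in l is compared. *)
Lemma xindep_le_zdiv x Z (T : finType) (u : T -> F) : x != 0 -> is_zdiv x Z -> xindep iota x u ->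
  #|T|%:Z <= ddeg Z.
Proof.
move=> x0 hZ xu; have [C [C0 hC]] := ell_multiples x0 hZ xu.
have H (l : nat) : (#|T| * l.+1)%:Z <= l%:Z * ddeg Z + ddeg C + 1.
  apply: le_trans (_ : (ell (dscale l%:Z Z ++ C))%:Z <= _); first by rewrite lez_nat.
  rewrite -ddeg_scale -ddeg_cat; apply: ell_effective => P.
  by rewrite dcoef_cat dcoef_scale hZ; have := C0 P; nia.
rewrite leNgt; apply/negP => lt.
pose l := (absz (ddeg C + 1)).+1; have := H l.
have : (ddeg Z + 1) * l%:Z <= #|T|%:Z * l%:Z by apply: ler_wpM2r; lia.
have : ddeg C + 1 < l%:Z by rewrite /l; lia.
move: (ddeg C) (ddeg Z) => c z; nia.
Qed.

Lemma zdiv_xindep x Z : x != 0 -> is_zdiv x Z ->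
  exists (T : finType) (u : T -> F), #|T|%:Z = ddeg Z /\ xindep iota x u.
Proof.
move=> x0 hZ; have [|s [hs ds]] := @effective_seq Z; first by move=> P; rewrite hZ; lia.
have [|T [u [cT xu]]] := zeros_xindep Hff (s := s) x0.
  move=> P; rewrite -hs hZ -has_pred1 has_count -ltz_nat -hs hZ; lia.
by exists T, u; rewrite ds cT.
Qed.

(** A family independent over K[x] is independent over K[1/x], so the degrees of the zero divisors
    of x and 1/x bound each other. *)
Lemma ddeg_principal x Z : x != 0 -> is_div x Z -> ddeg Z = 0.
Proof.
move=> x0 hZ; have [Z0 h0] := zdiv_ex x0.
have x0' : x^-1 != 0 by rewrite invr_eq0.
have [Z1 h1] := zdiv_ex x0'.
have -> : ddeg Z = ddeg (Z0 ++ dscale (-1) Z1).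
  by apply: eq_ddeg => P; rewrite dcoef_cat dcoef_scale hZ h0 h1 pvalV; lia.
have [T [u [cT xu]]] := zdiv_xindep x0 h0.
have [S [w [cS xw]]] := zdiv_xindep x0' h1.
have e1 := xindep_le_zdiv x0' h1 (xindep_inv x0 xu).
have := xindep_inv x0' xw; rewrite invrK => /(xindep_le_zdiv x0 h0) e2.
rewrite ddeg_cat ddeg_scale; lia.
Qed.

Lemma ell_shift A B Z f : f != 0 -> is_div f Z ->
  (forall P, dcoef B P = dcoef A P + dcoef Z P) -> ell B = ell A.
Proof.
move=> f0 hZ hB; apply: (rdim_uniq (subspace0 iota) (ellP B)).
apply: (rdim_scale f0 _ _ (ellP A)).
  move=> x; rewrite !LspaceE; split=> h P.
    by apply/(vgeZE _ _ _ f0); apply: vge_le (h P); rewrite hB hZ; lia.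
  by have /(vgeZE _ _ _ f0) := h P; apply: vge_le; rewrite hB hZ; lia.
move=> x; rewrite /zero_only; split=> [->|/eqP]; first by rewrite mulr0.
by rewrite mulf_eq0 (negbTE f0) => /eqP.
Qed.

(** Adding the divisor of a nonzero f in L(A) makes A effective within its class. *)
Lemma ell_gt0_effective A : (0 < ell A)%N ->
  exists B, [/\ effective B, ddeg B = ddeg A & ell B = ell A].
Proof.
move=> /ell_gt0 [f f0 /LspaceE hf]; have [Z hZ] := div_ex f0.
exists (A ++ Z); split=> [P||].
- by rewrite dcoef_cat hZ; case: (hf P) => [/eqP|]; [rewrite (negbTE f0)|lia].
- by rewrite ddeg_cat (ddeg_principal f0 hZ) addr0.
- by apply: (ell_shift f0 hZ) => P; rewrite dcoef_cat.
Qed.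

Lemma ell_neg A : ddeg A < 0 -> ell A = 0%N.
Proof.
move=> h; apply/eqP; rewrite -leqn0 leqNgt; apply/negP => /ell_gt0_effective [B [B0 dB _]].
have : ddeg ([::] : divisor iota) <= ddeg B by apply: ddeg_le => P; rewrite dcoef_nil.
by rewrite ddeg_nil dB leNgt h.
Qed.

Lemma ell_le_ddeg A : -1 <= ddeg A -> (ell A)%:Z <= ddeg A + 1.
Proof.
move=> h; case: (posnP (ell A)) => [->|/ell_gt0_effective [B [B0 <- <-]]]; first by lia.
exact: ell_effective.
Qed.

(* It suffices to treat the divisors l Z + C: a nonzero z in L(l Z + C - A'), where A' >= A, moves A
   below l Z + C inside its linear equivalence class. *)
Lemma riemann : exists c : int, forall A, ddeg A - (ell A)%:Z <= c.
Proof.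
have [[x [xP _]] _] := Hff.
have x0 : x != 0 by have := xP 'X; rewrite map_polyX hornerX polyX_eq0; apply.
have [Z hZ] := zdiv_ex x0.
have [T [u [cT xu]]] := zdiv_xindep x0 hZ.
have dZ : 0 < ddeg Z.
  have := xindep_le_zdiv x0 hZ (xindep1 xP); rewrite card_unit; lia.
have [C [C0 hC]] := ell_multiples x0 hZ xu.
(* This is the bound for l Z + C, because ell(l Z + C) >= (l + 1) deg Z. *)
exists (ddeg C - ddeg Z) => A.
have [s hs] := dcoef_bound A.
(* With l = deg A', where A' = [dsum s], ell(B - A') >= (l + 1) deg Z - l > 0. *)
pose l := `|ddeg (dsum s)|%N; pose B := dscale l%:Z Z ++ C.
have dB : ddeg B = l%:Z * ddeg Z + ddeg C by rewrite ddeg_cat ddeg_scale.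
have lB : l%:Z * ddeg Z + ddeg Z <= (ell B)%:Z.
  have := hC l; rewrite -/B; nia.
have ddsum : 0 <= ddeg (dsum s) by rewrite ddeg_dsum.
have [z z0 zB] : exists2 z, z != 0 & Lspace (B ++ dscale (-1) (dsum s)) z.
  apply: ell_gt0.
  have [|_] := @ell_mono (B ++ dscale (-1) (dsum s)) B.
    by move=> P; rewrite dcoef_cat dcoef_scale dcoef_dsum; lia.
  rewrite ddeg_cat ddeg_scale.
  have : ddeg (dsum s) <= l%:Z by rewrite /l; lia.
  nia.
have [Y hY] := div_ex z0.
have [Y' hY'] : exists Y', is_div z^-1 Y' by apply: div_ex; rewrite invr_eq0.
have eA : ell (A ++ Y') = ell A.
  by apply: (ell_shift _ hY'); rewrite ?invr_eq0 // => P; rewrite dcoef_cat.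
have dA : ddeg (A ++ Y') = ddeg A.
  by rewrite ddeg_cat (@ddeg_principal z^-1 Y') ?addr0 ?invr_eq0.
have [|_] := @ell_mono (A ++ Y') B; last by rewrite eA dA; lia.
move=> P; rewrite dcoef_cat hY' pvalV.
have /LspaceE/(_ P) := zB; rewrite dcoef_cat dcoef_scale dcoef_dsum => -[/eqP|].
  by rewrite (negbTE z0).
have := hs P; lia.
Qed.

(** The maximum exists: Riemann's theorem bounds the values, and the zero divisor gives the value
    0. *)
Lemma genusP : (forall A, ddeg A - (ell A)%:Z + 1 <= (genus iota)%:Z) /\
  exists A, ddeg A - (ell A)%:Z + 1 = (genus iota)%:Z.
Proof.
apply: (epsilon_spec _ (fun g : nat => (forall A, ddeg A - (ell A)%:Z + 1 <= g%:Z) /\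
  exists A, ddeg A - (ell A)%:Z + 1 = g%:Z)).
have [c hc] := riemann.
pose Pr (k : nat) := exists A, ddeg A - (ell A)%:Z + 1 = k%:Z.
have Pr0 : Pr 0%N by exists [::]; rewrite ddeg_nil ell_nil.
have [k [A hA] kmax] : exists2 r, Pr r & forall s, Pr s -> (s <= r)%N.
  apply: (ex_maxP (N := (absz (c + 1))) Pr0) => r [A hA]; have := hc A; lia.
exists k; split; last by exists A.
move=> B; case: (lerP 0 (ddeg B - (ell B)%:Z + 1)) => h; last by lia.
have := kmax (absz (ddeg B - (ell B)%:Z + 1)); rewrite -lez_nat gez0_abs //; apply.
by exists B; lia.
Qed.

(** Admissible degrees are nonnegative, and there are some, since ell(i Z + C) > i for the zero
    divisor Z of a transcendental x and suitable C. *)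
Lemma gamP i : (0 < i)%N -> (exists A, (i <= ell A)%N /\ ddeg A = gam iota i) /\
  forall A, (i <= ell A)%N -> gam iota i <= ddeg A.
Proof.
move=> i0.
apply: (epsilon_spec _ (fun d : int => (exists A, (i <= ell A)%N /\ ddeg A = d) /\
  forall A, (i <= ell A)%N -> d <= ddeg A)).
have dge A : (i <= ell A)%N -> 0 <= ddeg A.
  by move=> h; rewrite leNgt; apply/negP => /ell_neg E; move: h; rewrite E; lia.
have ex : exists d, cb (exists A, (i <= ell A)%N /\ ddeg A = d%:Z).
  have [[x [xP _]] _] := Hff.
  have x0 : x != 0 by have := xP 'X; rewrite map_polyX hornerX polyX_eq0; apply.
  have [Z hZ] := zdiv_ex x0.
  have [C [C0 hC]] := ell_multiples x0 hZ (xindep1 xP).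
  have h : (i <= ell (dscale i%:Z Z ++ C))%N by have := hC i; rewrite card_unit; lia.
  exists `|ddeg (dscale i%:Z Z ++ C)|%N; apply/cbP.
  by exists (dscale i%:Z Z ++ C); split=> //; have := dge _ h; lia.
case: (ex_minnP ex) => d /cbP [A [hA dA]] dmin.
exists d%:Z; split; first by exists A.
move=> B hB; have := dmin `|ddeg B|%N; have := dge _ hB => h.
rewrite -lez_nat gez0_abs //; apply; apply/cbP; exists B; split=> //; lia.
Qed.

(** For i = ell A > 0, gamma_i <= deg A, so i is a candidate in the maximum defining l~. That
    maximum exists because gamma_1 <= 0 and gamma_r >= r - 1. In degree -1 both sides are 0. *)
Lemma ell_le_ltil A : -1 <= ddeg A -> (ell A <= ltil iota (ddeg A))%N.
Proof.
move=> h; rewrite /ltil; case: ifP => [/ell_neg -> //|]; move/negbT; rewrite -leNgt => d0.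
set Q := fun i : nat => _.
have /(epsilon_spec (inhabits 0%N) Q) [_ _ hmax] : exists i, Q i.
  pose Pr i := (1 <= i)%N /\ gam iota i <= ddeg A.
  have Pr1 : Pr 1%N.
    split=> //; have [_ /(_ [::])] := @gamP 1 isT; rewrite ell_nil ddeg_nil => /(_ isT) h1.
    exact: le_trans h1 d0.
  have [|r [h1 h2] h3] := ex_maxP (N := (absz (ddeg A + 1))) Pr1.
    move=> r [r1 hr]; have [[B [hB dB]] _] := gamP r1.
    have : -1 <= ddeg B.
      by rewrite leNgt; apply/negP => h2; have E : ell B = 0%N by [apply: ell_neg; lia]; lia.
    by move=> /ell_le_ddeg; lia.
  by exists r; split=> // j j1 j2; apply: h3.
case: (posnP (ell A)) => [-> //|e0]; apply: hmax => //.
by have [_] := gamP e0; apply.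
Qed.

End Riemann.
End Divisors.

(** * Codes *)

Section SetDimension.
Variables (K : finFieldType) (m : nat).

(** [sdim] is the rank of the matrix listing all words of S, so generators bound it above and
    independent words bound it below. *)
Lemma sdim_le (S : {set 'rV[K]_m}) r (g : 'I_r -> 'rV[K]_m) :
  (forall x, x \in S -> exists c : 'I_r -> K, x = \sum_t c t *: g t) -> (sdim S <= r)%N.
Proof.
move=> h; pose N := \matrix_(t < r) g t.
apply: leq_trans (rank_leq_row N); apply: mxrankS; apply/row_subP => i; rewrite rowK.
have [|c ->] := h (enum_val i); first exact: enum_valP.
apply: summx_sub => t _; apply: scalemx_sub; rewrite -[g t](rowK (fun t => g t)); exact: row_sub.
Qed.

Lemma sdim_ge (S : {set 'rV[K]_m}) r (g : 'I_r -> 'rV[K]_m) : (forall t, g t \in S) ->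
  (forall c : 'I_r -> K, \sum_t c t *: g t = 0 -> forall t, c t = 0) -> (r <= sdim S)%N.
Proof.
move=> gS hg; pose N := \matrix_(t < r) g t.
have /eqP <- : row_free N.
  rewrite -kermx_eq0; apply/rowV0P => v /sub_kermxP; rewrite mulmx_sum_row => hv.
  apply/rowP => t; rewrite mxE; apply: (hg (fun t => v 0 t)); rewrite -[RHS]hv.
  by apply: eq_bigr => s _; rewrite rowK.
apply: mxrankS; apply/row_subP => t; rewrite rowK.
have -> : g t = row (enum_rank_in (gS t) (g t)) (\matrix_(r < #|S|) (@enum_val _ (mem S) r)).
  by rewrite rowK enum_rankK_in.
exact: row_sub.
Qed.

End SetDimension.

(** * Evaluation at rational places and the subcodes of an AG code *)

Section Evaluation.
Variables (K : finFieldType) (F : fieldType) (iota : {rmorphism K -> F}).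
Hypothesis Hff : function_field iota.

Section RationalPlace.
Variable P : place iota.
Hypothesis hP : pdeg P = 1%N.

Lemma evalpP f : inval P f -> inmax P (f - iota (evalp P f)).
Proof.
move=> hf; apply: (epsilon_spec _ (fun c => inmax P (f - iota c))).
have := pdegP Hff P; rewrite hP => -[y [yV [yf ys]]].
have E c : lincomb iota c y = iota (c ord0) * y ord0 by rewrite /lincomb big_ord1.
have [c] := ys _ hf; rewrite E => hc.
have [|d] := ys 1; first by right; rewrite pval1.
rewrite E => hd.
have d0 : d ord0 != 0.
  apply/eqP => d0; move: hd; rewrite d0 rmorph0 mul0r subr0 => -[/eqP|]; first by rewrite oner_eq0.
  by rewrite pval1.
(* With y a residue basis, f = c y and 1 = d y modulo P, so f has residue c/d. *)
exists (c ord0 / d ord0).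
have -> : f - iota (c ord0 / d ord0) = (f - iota (c ord0) * y ord0) -
    iota (c ord0 / d ord0) * (1 - iota (d ord0) * y ord0).
  rewrite fmorph_div; field; by rewrite fmorph_eq0.
by apply: (subspaceB (inmax_subspace P)) => //; apply: (subspaceZ _ (inmax_subspace P)).
Qed.

Lemma evalp_uniq f c : inval P f -> inmax P (f - iota c) -> evalp P f = c.
Proof.
move=> hf hc; have := subspaceB (inmax_subspace P) hc (evalpP hf).
have -> : f - iota c - (f - iota (evalp P f)) = iota (evalp P f - c) by rewrite rmorphB; ring.
case=> [/eqP|]; last by rewrite pval_iota.
by rewrite fmorph_eq0 subr_eq0 => /eqP.
Qed.

Lemma evalp_eq0 f : inval P f -> evalp P f = 0 -> inmax P f.
Proof. by move=> /evalpP; move=> h E; move: h; rewrite E rmorph0 subr0. Qed.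

Lemma evalp_comb (T : finType) (c : T -> K) (f : T -> F) : (forall t, inval P (f t)) ->
  evalp P (comb iota c f) = \sum_t c t * evalp P (f t).
Proof.
move=> hf; apply: evalp_uniq; first exact: subspace_comb (inval_subspace P) hf.
rewrite rmorph_sum /comb -sumrB; apply: (subspace_sum (inmax_subspace P)) => t.
rewrite rmorphM -mulrBr; apply: (subspaceZ _ (inmax_subspace P)); exact: evalpP.
Qed.

End RationalPlace.

Section Code.
Variables (n : nat) (P : 'I_n -> place iota) (G : divisor iota).
Hypotheses (HPinj : injective P) (HPrat : forall i, pdeg (P i) = 1%N)
  (HG : forall i, dcoef G (P i) = 0).

(** The divisor of the functions in L(G) that vanish at the points selected by [p]. *)
Definition subD (p : pred 'I_n) : divisor iota :=
  G ++ dscale (-1) (dsum [seq P j | j <- enum 'I_n & p j]).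

Lemma dcoef_subD p Q : dcoef (subD p) Q = dcoef G Q - (Q \in [seq P j | j <- enum 'I_n & p j])%:Z.
Proof.
rewrite dcoef_cat dcoef_scale dcoef_dsum mulN1r count_uniq_mem //.
by rewrite map_inj_uniq // filter_uniq // enum_uniq.
Qed.

Lemma ddeg_subD p : ddeg (subD p) = ddeg G - (\sum_(j | p j) 1)%N%:Z.
Proof.
rewrite ddeg_cat ddeg_scale ddeg_dsum mulN1r big_map; congr (_ - Posz _).
rewrite big_filter big_enum_cond /=; apply: eq_bigr => j _; exact: HPrat.
Qed.

Lemma subD_inval p f i : Lspace (subD p) f -> inval (P i) f.
Proof.
move=> /LspaceE /(_ (P i)); apply: vge_le; rewrite dcoef_subD HG.
by case: (_ \in _).
Qed.

Lemma G_inval f i : Lspace G f -> inval (P i) f.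
Proof. by move=> /LspaceE /(_ (P i)); rewrite HG. Qed.

(** G has coefficient 0 at P_j, so a zero there is exactly what lowering it to -1 requires. *)
Lemma subD_Lspace (p : pred _) f : Lspace G f -> (forall j, p j -> evalp (P j) f = 0) -> Lspace (subD p) f.
Proof.
move=> hf hp; apply/LspaceE => Q; rewrite dcoef_subD.
case: mapP => [[j]|_]; last by have /LspaceE := hf; rewrite subr0.
rewrite mem_filter => /andP[pj _] ->; rewrite HG.
by apply/inmaxE; apply: evalp_eq0 => //; [apply: G_inval|apply: hp].
Qed.

(** By linearity of evaluation, the evaluated basis of the L-space generates S; [h] tells which
    points the coordinates of S refer to. *)
Lemma sdim_le_ell m (S : {set 'rV[K]_m}) (h : 'I_m -> 'I_n) p :
  (forall x, x \in S -> exists2 f, Lspace (subD p) f & forall k, x 0 k = evalp (P (h k)) f) ->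
  (sdim S <= ell (subD p))%N.
Proof.
move=> hS; have [b [bV [_ bs]]] := ellP Hff (subD p).
apply: (@sdim_le _ _ _ _ (fun t => \row_k evalp (P (h k)) (b t))) => x /hS [f /bs [c hc] xf].
exists c; apply/rowP => k; rewrite xf summxE.
have -> : f = comb iota c b by apply/eqP; rewrite -subr_eq0; apply/eqP.
rewrite evalp_comb //; first by apply: eq_bigr => t _; rewrite !mxE.
by move=> t; apply: subD_inval (bV t).
Qed.

(** L(G - D) is the kernel of evaluation on L(G), so functions independent modulo it give
    independent codewords. *)
Lemma ell_le_sdim : (ell G <= sdim (AGcode P G) + ell (subD predT))%N.
Proof.
have GL x : Lspace (subD predT) x -> Lspace G x.
  by move=> /LspaceE h; apply/LspaceE; apply: Lf_le h => Q; rewrite dcoef_subD; lia.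
have [t _ ht] : exists2 t, (t <= ell G)%N & rdim iota (Lspace G) (Lspace (subD predT)) t.
  apply: free_rdim_ex; first exact: Lspace_subspace.
  move=> r f fV ff; rewrite -(card_ord r); apply: (free_rdim_le (subspace0 iota) (ellP Hff G) fV).
  by move=> c hc; apply: ff; rewrite hc; left.
have -> : ell G = (t + ell (subD predT))%N.
  apply: (rdim_uniq (subspace0 iota) (ellP Hff G)).
  apply: (rdim_add (Lspace_subspace _) (subspace0 iota)) ht (ellP Hff _) => //.
  by move=> x ->; left.
rewrite leq_add2r; case: ht => f [fV [ff _]].
apply: (@sdim_ge _ _ _ _ (fun t => \row_i evalp (P i) (f t))).
  by move=> s; rewrite inE; apply/cbP; exists (f s).
move=> c hc; apply: ff; apply: subD_Lspace.
  exact: subspace_comb (Lspace_subspace G) fV.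
move=> j _; rewrite evalp_comb //; last by move=> s; apply: G_inval.
have /rowP/(_ j) := hc; rewrite summxE mxE => h; apply: etrans h.
by apply: eq_bigr => s _; rewrite !mxE.
Qed.

Lemma sdim_AGcode_le : (sdim (AGcode P G) <= ell G)%N.
Proof.
have -> : ell G = ell (subD pred0).
  by apply: (eq_ell Hff) => Q; rewrite dcoef_subD filter_pred0 subr0.
apply: (@sdim_le_ell _ _ id) => x; rewrite inE => /cbP [f [hf ->]].
exists f => [|k]; last by rewrite mxE.
exact: subD_Lspace.
Qed.

Lemma sdim_past (i : 'I_n.+1) :
  (sdim (pastset (AGcode P G) i) <= ell (subD (fun j : 'I_n => (i <= j)%N)))%N.
Proof.
have hi : (i <= n)%N by rewrite -ltnS.
apply: (@sdim_le_ell _ _ (widen_ord hi)) => x; rewrite inE => /existsP[c].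
rewrite inE => /andP[/cbP [f [hf cf]] /andP[/forallP h1 /forallP h2]].
exists f.
  apply: subD_Lspace => // j ij; have := implyP (h2 j) ij.
  by rewrite cf mxE => /eqP.
move=> k; have /forallP/(_ k)/implyP/(_ (eqxx _))/eqP := h1 (widen_ord hi k).
by rewrite cf mxE.
Qed.

Lemma sdim_future (i : 'I_n.+1) :
  (sdim (futureset (AGcode P G) i) <= ell (subD (fun j : 'I_n => (j < i)%N)))%N.
Proof.
have hi (k : 'I_(n - i)) : (i + k < n)%N by have := ltn_ord k; lia.
apply: (@sdim_le_ell _ _ (fun k => Ordinal (hi k))) => x; rewrite inE => /existsP[c].
rewrite inE => /andP[/cbP [f [hf cf]] /andP[/forallP h1 /forallP h2]].
exists f.
  apply: subD_Lspace => // j ij; have := implyP (h1 j) ij.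
  by rewrite cf mxE => /eqP.
move=> k; have /forallP/(_ k)/implyP/(_ (eqxx _))/eqP := h2 (Ordinal (hi k)).
by rewrite cf mxE.
Qed.

Lemma RfunP (N : int) : exists a : nat, (a <= absz (N + 2)%R)%N /\
  Rfun iota N = (ltil iota (a%:Z - 1) + ltil iota (N + 1 - a%:Z))%N.
Proof. by rewrite /Rfun; eexists; split; last reflexivity; rewrite -ltnS; apply: ltn_ord. Qed.

Lemma Delta_AGcode_le : ddeg G < n%:Z -> -1 <= 2 * ddeg G - n%:Z ->
  (Delta (AGcode P G) <= Rfun iota (2 * ddeg G - n%:Z)%R)%N.
Proof.
set m := ddeg G => mn Hm; have [a [an ->]] := RfunP (2 * m - n%:Z).
(* This i gives m - (n - i) = a - 1 and m - i = 2m - n + 1 - a, the two arguments of l~. From m < n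
   and 0 <= a <= 2m - n + 2 follows 0 <= i <= n. *)
pose i := absz (a%:Z - 1 - m + n%:Z).
have Ei : i%:Z = a%:Z - 1 - m + n%:Z by rewrite /i; lia.
have hi : (i < n.+1)%N by lia.
apply: leq_trans (_ : Delta_i (AGcode P G) (Ordinal hi) <= _)%N.
  by rewrite /Delta; case: arg_minnP => // j _; apply.
apply: leq_add.
  apply: leq_trans (sdim_past _) _.
  have E : ddeg (subD (fun j : 'I_n => (i <= j)%N)) = a%:Z - 1.
    rewrite ddeg_subD -/m -(big_geq_mkord i n predT (fun=> 1%N)) sum_nat_const_nat muln1.
    by rewrite -subzn; lia.
  by rewrite -E; apply: ell_le_ltil => //; rewrite E; lia.
apply: leq_trans (sdim_future _) _.
have E : ddeg (subD (fun j : 'I_n => (j < i)%N)) = 2 * m - n%:Z + 1 - a%:Z.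
  rewrite ddeg_subD -/m -(big_ord_widen n (fun=> 1%N)) // sum1_card card_ord; lia.
by rewrite -E; apply: ell_le_ltil => //; rewrite E; lia.
Qed.

Lemma ddeg_lt_of_sdim : (2 * sdim (AGcode P G) <= n)%N -> (2 * genus iota < n)%N -> ddeg G < n%:Z.
Proof.
move=> Hk Hg; rewrite ltNge; apply/negP => nm.
have [hg _] := genusP Hff; have := hg G; have := ell_le_sdim.
have E : ddeg (subD predT) = ddeg G - n%:Z by rewrite ddeg_subD sum1_card card_ord.
have := ell_le_ddeg Hff (A := subD predT); rewrite E; lia.
Qed.

(** Evaluation is injective, as G - D has negative degree. *)
Lemma sdim_AGcode : ddeg G < n%:Z -> sdim (AGcode P G) = ell G.
Proof.
move=> h; apply/eqP; rewrite eqn_leq sdim_AGcode_le /=; have := ell_le_sdim.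
by rewrite (ell_neg Hff (A := subD predT)) ?addn0 // ddeg_subD sum1_card card_ord subr_lt0.
Qed.

End Code.

(** Permuting coordinates permutes the points, so a bound for every order of the points covers the
    whole class [C]. *)
Lemma permcode_AGcode n (P : 'I_n -> place iota) (G : divisor iota) (s : 'S_n) :
  permcode s (AGcode P G) = AGcode (fun i => P (s i)) G.
Proof.
apply/setP => x; rewrite [in RHS]inE; apply/imsetP/cbP => [[c]|[f [hf ->]]].
  rewrite inE => /cbP [f [hf ->]] ->; exists f; split=> //.
  by apply/rowP => j; rewrite !mxE.
exists (\row_i evalp (P i) f); first by rewrite inE; apply/cbP; exists f.
by apply/rowP => j; rewrite !mxE.
Qed.

End Evaluation.

Theorem theorem3p4 (K : finFieldType) (F : fieldType) (iota : {rmorphism K -> F})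
  (Hff : function_field iota)
  (n : nat) (P : 'I_n -> place iota) (HPinj : injective P)
  (HPrat : forall i, pdeg (P i) = 1%N)
  (G : divisor iota) (HG : forall i, dcoef G (P i) = 0)
  (Hk : (2 * sdim (AGcode P G) <= n)%N)
  (Hg : (2 * genus iota < n)%N)
  (Hm : -1 <= (2 : int) * ddeg G - n%:Z) :
  (DeltaP (AGcode P G) <= Rfun iota ((2 : int) * ddeg G - n%:Z)%R)%N /\
  (wcode (AGcode P G))%:Z - (Rfun iota ((2 : int) * ddeg G - n%:Z)%R)%:Z <= (scompP (AGcode P G))%:Z.
Proof.
have mn := ddeg_lt_of_sdim Hff HPinj HPrat HG Hk Hg.
have injs (s : 'S_n) : injective (fun i => P (s i)) by move=> i j /HPinj /perm_inj.
have hD (s : 'S_n) : (Delta (permcode s (AGcode P G)) <= Rfun iota (2 * ddeg G - n%:Z)%R)%N.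
  by rewrite permcode_AGcode; apply: Delta_AGcode_le.
have hk (s : 'S_n) : sdim (permcode s (AGcode P G)) = sdim (AGcode P G).
  by rewrite permcode_AGcode !sdim_AGcode.
split; first exact: hD.
(* The minimum is k - Delta for one particular order, where Delta <= R. Truncated subtraction in
   [scomp] can only raise the value. *)
rewrite /scompP {1}/scomp hk /wcode; set d := Delta _; have : (d <= _)%N := hD _.
move: Hk; move: (sdim _) (Rfun _ _) => k r; lia.
Qed.
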